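(* Every two-rooted graph $(\hat H,\hat s,\hat t)$ admits a proper PE-sequence. Moreover, for an arbitrary PE-sequence $S$ of $(\hat H,\hat s,\hat t)$, its limit graph $G(S)$ is an induced subgraph of the limit graph of some proper PE-sequence of $(\hat H,\hat s,\hat t)$. Furthermore, if $\hat H$ is connected, then the limit graphs of all proper PE-sequences of $(\hat H,\hat s,\hat t)$ are isomorphic to each other.
   Context: Graphs are simple and undirected; the limit graphs below may be infinite. A two-rooted graph is a triple $(H,s,t)$ with $H$ a finite graph and $s,t\in V(H)$ not necessarily distinct. A copy of $(\hat H,\hat s,\hat t)$ in a graph $G$ is $(H,s,t)$ with $H$ an induced subgraph of $G$ and an isomorphism $\hat H\to H$ mapping $\hat s\mapsto s$, $\hat t\mapsto t$. An extension of such a copy in $G$ is $(H',s',t')$ with $H'$ an induced subgraph of $G$, $V(H')=V(H)\cup\{s',t'\}$, $s'\ne t'$ not in $V(H)$, $H'-\{s',t'\}=H$, and $s$ (resp. $t$) the unique neighbour of $s'$ (resp. $t'$) in $H'$. A copy is simplicial in $G$ if it has no extension in $G$. Given a simplicial copy $(H,s,t)$ of $(\hat H,\hat s,\hat t)$ in $G$, a pendant extension (PE) of $G$ with respect to $(H,s,t)$ is any graph obtained from $G$ by adding the minimum possible number of pendant edges (to new vertices) at $s$ and/or $t$ so that $(H,s,t)$ becomes non-simplicial. A PE-sequence of $(\hat H,\hat s,\hat t)$ is a finite or infinite sequence $(G_i)_{i\ge0}$ with $G_0=\hat H$ such that, for each $i$, if $G_i$ contains a simplicial copy of $(\hat H,\hat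 s,\hat t)$ then $G_{i+1}$ is a PE of $G_i$ with respect to some simplicial copy, and otherwise the sequence ends with $G_i$. The limit graph $G(S)$ of $S=(G_0,G_1,\dots)$ has vertex set $\bigcup_i V(G_i)$ and edge set $\bigcup_i E(G_i)$. A PE-sequence $S$ is proper if $G(S)$ contains no simplicial copy of $(\hat H,\hat s,\hat t)$. *)

(* Defs.v *)
From Stdlib Require Import Relation_Operators.
From mathcomp Require Import all_boot all_classical.

Set Implicit Arguments.
Unset Strict Implicit.
Unset Printing Implicit Defensive.

Local Open Scope classical_set_scope.
Local Open Scope card_scope.

(* All graphs have their vertices in a common type U, so that unions of graphs
   and (induced) subgraph relations are literal. *)
Record graph (U : Type) := Graph {
  vert : set U;
  adj : U -> U -> Prop;
  adj_vert : forall x y, adj x y -> vert x;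
  adj_sym : forall x y, adj x y -> adj y x;
  adj_irrefl : forall x, ~ adj x x }.

Definition induced_subgraph (U : Type) (H G : graph U) : Prop :=
  vert H `<=` vert G /\
  forall x y, vert H x -> vert H y -> (adj H x y <-> adj G x y).

Definition graph_iso (U : Type) (G G' : graph U) (f : U -> U) : Prop :=
  set_bij (vert G) (vert G') f /\
  forall x y, vert G x -> vert G y -> (adj G x y <-> adj G' (f x) (f y)).

Definition isomorphic (U : Type) (G G' : graph U) : Prop :=
  exists f, graph_iso G G' f.

Definition graph_connected (U : Type) (G : graph U) : Prop :=
  vert G !=set0 /\
  forall x y, vert G x -> vert G y -> clos_refl_trans U (adj G) x y.

Section DelVert.
Variables (U : Type) (G : graph U) (A : set U).

Definition del_adj (x y : U) : Prop := [/\ adj G x y, ~ A x & ~ A y].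

Lemma del_adj_vert x y : del_adj x y -> (vert G `\` A) x.
Proof. by move=> [Gxy nAx _]; split=> //; exact: adj_vert Gxy. Qed.

Lemma del_adj_sym x y : del_adj x y -> del_adj y x.
Proof. by move=> [Gxy nAx nAy]; split=> //; exact: adj_sym. Qed.

Lemma del_adj_irrefl x : ~ del_adj x x.
Proof. by move=> [Gxx _ _]; exact: adj_irrefl Gxx. Qed.

Definition del_vert : graph U :=
  Graph del_adj_vert del_adj_sym del_adj_irrefl.

End DelVert.

Record two_rooted (U : Type) := TwoRooted {
  tr_graph :> graph U;
  root_s : U;
  root_t : U;
  tr_finite : finite_set (vert tr_graph);
  root_s_vert : vert tr_graph root_s;
  root_t_vert : vert tr_graph root_t }.

Definition is_copy (U : Type) (Hh : two_rooted U) (G : graph U)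
    (H : two_rooted U) : Prop :=
  induced_subgraph H G /\
  exists f, [/\ graph_iso Hh H f, f (root_s Hh) = root_s H
              & f (root_t Hh) = root_t H].

Definition is_extension (U : Type) (G : graph U) (H : two_rooted U)
    (H' : graph U) (s' t' : U) : Prop :=
  [/\ induced_subgraph H' G /\ vert H' = vert H `|` [set s'; t'],
      [/\ s' <> t', ~ vert H s' & ~ vert H t'],
      del_vert H' [set s'; t'] = H,
      (forall v, adj H' s' v <-> v = root_s H)
    & (forall v, adj H' t' v <-> v = root_t H)].

Definition has_extension (U : Type) (G : graph U) (H : two_rooted U) : Prop :=
  exists H' s' t', is_extension G H H' s' t'.

Definition simplicial_copy (U : Type) (Hh : two_rooted U) (G : graph U)
    (H : two_rooted U) : Prop :=
  is_copy Hh G H /\ ~ has_extension G H.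

(* G' is obtained from G by adding k pendant edges, each joining a new vertex
   (an element of W) to s or to t. *)
Definition adds_pendants (U : Type) (G : graph U) (s t : U) (k : nat)
    (G' : graph U) : Prop :=
  exists W : set U,
    [/\ W #= `I_k, W `&` vert G = set0, vert G' = vert G `|` W,
        induced_subgraph G G'
      & forall w, W w ->
          exists2 r, r = s \/ r = t & forall v, adj G' w v <-> v = r].

Definition pendant_extension (U : Type) (G : graph U) (H : two_rooted U)
    (G' : graph U) : Prop :=
  exists k,
    [/\ adds_pendants G (root_s H) (root_t H) k G', has_extension G' H
      & forall k' G'', adds_pendants G (root_s H) (root_t H) k' G'' ->
          has_extension G'' H -> (k <= k')%N].

(* A finite or infinite sequence of graphs is a function to option (graph U):
   S i = None means that the sequence has ended before index i. *)
Definition PE_sequence (U : Type) (Hh : two_rooted U)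
    (S : nat -> option (graph U)) : Prop :=
  S 0%N = Some (tr_graph Hh) /\
  forall i,
    match S i with
    | None => S i.+1 = None
    | Some G =>
        ((exists H, simplicial_copy Hh G H) ->
          exists H G', [/\ simplicial_copy Hh G H, pendant_extension G H G'
                         & S i.+1 = Some G']) /\
        (~ (exists H, simplicial_copy Hh G H) -> S i.+1 = None)
    end.

Section LimitGraph.
Variables (U : Type) (S : nat -> option (graph U)).

Definition limit_vert : set U :=
  [set x | exists i G, S i = Some G /\ vert G x].

Definition limit_adj (x y : U) : Prop :=
  exists i G, S i = Some G /\ adj G x y.

Lemma limit_adj_vert x y : limit_adj x y -> limit_vert x.
Proof. by move=> [i [G [SG Gxy]]]; exists i, G; split=> //; exact: adj_vert Gxy. Qed.

Lemma limit_adj_sym x y : limit_adj x y -> limit_adj y x.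
Proof. by move=> [i [G [SG Gxy]]]; exists i, G; split=> //; exact: adj_sym. Qed.

Lemma limit_adj_irrefl x : ~ limit_adj x x.
Proof. by move=> [i [G [SG Gxx]]]; exact: adj_irrefl Gxx. Qed.

Definition limit_graph : graph U :=
  Graph limit_adj_vert limit_adj_sym limit_adj_irrefl.

End LimitGraph.

Definition proper_PE_sequence (U : Type) (Hh : two_rooted U)
    (S : nat -> option (graph U)) : Prop :=
  PE_sequence Hh S /\ ~ exists H, simplicial_copy Hh (limit_graph S) H.

(* Main.v *)
(* Every limit graph is the base graph with trees attached: a vertex born at
   some step has exactly one older neighbour, its parent.

   Uniqueness.  Partial isomorphisms between two proper limits that fix the base
   and are closed under parents and older siblings can always be enlarged: the
   first-born unmatched vertex was attached at a root of some copy, the image of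
   this copy is not simplicial in the other limit, and the minimality of the
   pendant extension yields an unmatched child of the corresponding root there.
   Connectedness of the base excludes the one situation in which a pendant
   extension has a choice between two distinct roots, namely when private
   neighbours of the two roots exist and are all joined: the roots would then
   lie on a cycle through vertices outside the copy, whereas the copy contains
   the 2-core of the limit.

   Extension.  Limits are locally finite, since a vertex receives a new pendant
   edge only while it has few children.  Hence for every vertex v the given
   sequence stops after finitely many steps attaching vertices near v, and from
   then on copies rooted at v can be repaired with fresh vertices without
   altering later steps of the sequence.  Dovetailing these repairs with the
   sequence over an enumeration of the countably many possible copies leaves no
   simplicial copy. *)
Require Import Defs.
From Stdlib Require Import Relation_Operators.
From mathcomp Require Import all_boot finmap zify all_classical.

Set Implicit Arguments.
Unset Strict Implicit.
Unset Printing Implicit Defensive.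

Local Open Scope classical_set_scope.
Local Open Scope card_scope.

(** * Cardinality of sets and injections *)

Lemma injection_card_le T T' (A : set T) (B : set T') (f : T -> T') :
  (forall x, A x -> B (f x)) ->
  (forall x y, A x -> A y -> f x = f y -> x = y) -> A #<= B.
Proof.
move=> fAB fI.
have : $|{injfun A >-> B}|.
  apply/injfunPex; exists f => // x y; rewrite !inE; exact: fI.
by case=> h; exact: inj_card_le h.
Qed.

Lemma card_le_injection T T' (x0 : T') (A : set T) (B : set T') :
  A #<= B -> exists f : T -> T', (forall x, A x -> B (f x)) /\
    (forall x y, A x -> A y -> f x = f y -> x = y).
Proof.
move=> /card_leP/injfunPex[g _ gI].
exists (fun x => if pselect (A x) is left Ax
                 then set_val (g (SigSub (mem_set Ax))) else x0); split=> x.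
  by case: pselect => // Ax _; exact: set_valP.
move=> y Ax Ay; case: pselect => // Ax'; case: pselect => // Ay' /val_inj.
by move=> /gI; rewrite !inE => /(_ I I) [].
Qed.

Lemma finite_subset_full T (A B : set T) :
  finite_set B -> A `<=` B -> B #<= A -> B `<=` A.
Proof.
(* [fset_set] needs a choice type; [Pchoice] equips the arbitrary type [T] with such a structure. *)
elim/Pchoice: T A B => T A B finB AB BA.
have finA : finite_set A by exact: sub_finite_set finB.
have sAB := AB; rewrite (fset_set_sub finA finB) in sAB.
have [n An] := finA; have := finB => -[m Bm].
have mn : (m <= n)%N.
  by rewrite -card_le_II -(card_le_eql Bm) -(card_le_eqr An).
have : fset_set A = fset_set B.
  by apply/eqP; rewrite eqEfcard sAB (card_fset_set An) (card_fset_set Bm).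
by move=> /(fset_set_inj finA finB) ->.
Qed.

Lemma finite_injection_onto T (C : set T) (f : T -> T) : finite_set C ->
  (forall x, C x -> C (f x)) ->
  (forall x y, C x -> C y -> f x = f y -> x = y) ->
  forall y, C y -> exists2 x, C x & f x = y.
Proof.
move=> finC fC fI y Cy.
have : C `<=` f @` C.
  apply: finite_subset_full => //; first by move=> _ [x Cx <-]; exact: fC.
  by apply: (@injection_card_le _ _ _ _ f) => // x Cx; exists x.
by move=> /(_ y Cy) [x Cx <-]; exists x.
Qed.

(** * Graphs and extensions of copies *)

Section GraphOf.
Variables (U : Type) (V : set U) (E : U -> U -> Prop).

Definition graph_of_adj x y := [/\ V x, V y, x <> y & E x y \/ E y x].

Lemma graph_of_adj_vert x y : graph_of_adj x y -> V x.
Proof. by case. Qed.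

Lemma graph_of_adj_sym x y : graph_of_adj x y -> graph_of_adj y x.
Proof. by case=> Vx Vy xy Exy; split=> //; [exact/nesym | case: Exy; auto]. Qed.

Lemma graph_of_adj_irrefl x : ~ graph_of_adj x x.
Proof. by case. Qed.

Definition graph_of : graph U :=
  Graph graph_of_adj_vert graph_of_adj_sym graph_of_adj_irrefl.

End GraphOf.

Section Basics.
Variable U : Type.
Implicit Types (G : graph U) (H : two_rooted U) (X N : set U).

(** [is_extension] asks for an equality of graphs as records; the proof fields agree by proof
    irrelevance. *)
Lemma graph_ext G (G' : graph U) : (forall x, vert G x <-> vert G' x) ->
  (forall x y, adj G x y <-> adj G' x y) -> G = G'.
Proof.
case: G => v a p q r; case: G' => v' a' p' q' r' /= hv ha.
have ev : v = v' by apply/funext => x; apply/propext.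
have ea : a = a' by apply/funext => x; apply/funext => y; apply/propext.
by subst v' a'; congr Graph; exact: Prop_irrelevance.
Qed.

Lemma adjC G x y : adj G x y -> adj G y x.
Proof. exact: adj_sym. Qed.

Lemma adjxx G x : ~ adj G x x.
Proof. exact: adj_irrefl. Qed.

Lemma adj_vert1 G x y : adj G x y -> vert G x.
Proof. exact: adj_vert. Qed.

Lemma adj_vert2 G x y : adj G x y -> vert G y.
Proof. by move=> Gxy; exact: adj_vert (adj_sym Gxy). Qed.

Lemma adj_neq G x y : adj G x y -> x <> y.
Proof. by move=> Gxy exy; move: Gxy; rewrite exy; exact: adj_irrefl. Qed.

Lemma induced_refl G : induced_subgraph G G.
Proof. by split. Qed.

Lemma induced_trans G1 G2 G3 : induced_subgraph G1 G2 ->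
  induced_subgraph G2 G3 -> induced_subgraph G1 G3.
Proof.
move=> [v12 a12] [v23 a23]; split; first exact: subset_trans v23.
by move=> x y Vx Vy; rewrite a12// a23//; exact: v12.
Qed.

Lemma adj_graph_of_sub G V x y :
  adj (graph_of V (adj G)) x y <-> [/\ V x, V y & adj G x y].
Proof.
split=> [[Vx Vy _ [|/adjC]]//|[Vx Vy Gxy]].
by split=> //; [exact: adj_neq Gxy | left].
Qed.

Lemma induced_graph_of G V : V `<=` vert G ->
  induced_subgraph (graph_of V (adj G)) G.
Proof.
move=> VG; split=> // x y Vx Vy; rewrite adj_graph_of_sub//.
by split=> [[]|].
Qed.

(* [x] is eligible as the new vertex of an extension attached to the root [r]
   of a copy with vertex set [X]. *)
Definition priv G X (r x : U) : Prop :=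
  [/\ vert G x, ~ X x & forall v, X v -> (adj G x v <-> v = r)].

Definition ext_pair G X (s t a c : U) : Prop :=
  [/\ priv G X s a, priv G X t c, a <> c & ~ adj G a c].

Definition no_ext G X s t : Prop := forall a c, ~ ext_pair G X s t a c.

(** An extension is determined by its two new vertices, being induced on them and the copy. Its
    existence is thus a condition on adjacency in [G] alone. *)
Lemma has_extP G H : induced_subgraph H G -> has_extension G H <->
  exists a c, ext_pair G (vert H) (root_s H) (root_t H) a c.
Proof.
move=> [HG iHG].
have Hs := root_s_vert H; have Ht := root_t_vert H.
split=> [[H' [s' [t' [[[vG iG] vH'] [st nHs nHt] _ Ns Nt]]]]|
         [a [c [[Ga nHa Na] [Gc nHc Nc] ac nac]]]].
  have H's : vert H' s' by rewrite vH'; right; left.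
  have H't : vert H' t' by rewrite vH'; right; right.
  have H'H v : vert H v -> vert H' v by rewrite vH'; left.
  exists s', t'; split=> //.
  - split=> //; first exact: vG.
    by move=> v /H'H Hv; rewrite -iG// Ns.
  - split=> //; first exact: vG.
    by move=> v /H'H Hv; rewrite -iG// Nt.
  - by rewrite -iG// Ns => e; apply: nHt; rewrite e.
pose V := vert H `|` [set a; c].
have VG : V `<=` vert G by move=> x [/HG//|[]->].
exists (graph_of V (adj G)), a, c; split=> //.
- by split=> //; exact: induced_graph_of.
- apply: graph_ext => [x|x y] /=.
    split=> [[[//|ac'] nac']|Hx]; first by case: (nac').
    split; first by left.
    by case=> e; [apply: nHa | apply: nHc]; rewrite -e.
  split=> [[/adj_graph_of_sub[Vx Vy Gxy] nx ny]|Hxy].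
    by case: Vx => // Hx; case: Vy => // Hy; apply/iHG.
  have Hx := adj_vert Hxy; have Hy := adj_vert2 Hxy.
  split.
  - by apply/adj_graph_of_sub=> //; split; [left|left|apply/iHG].
  - by case=> e; [apply: nHa | apply: nHc]; rewrite -e.
  - by case=> e; [apply: nHa | apply: nHc]; rewrite -e.
- move=> v; rewrite adj_graph_of_sub//; split=> [[_ Vv Gav]|->].
    case: Vv Gav => [Hv /(Na _ Hv)//|[->|->//]]; by move/adjxx.
  by split; [right; left|left|apply/Na].
- move=> v; rewrite adj_graph_of_sub//; split=> [[_ Vv Gcv]|->].
    case: Vv Gcv => [Hv /(Nc _ Hv)//|[->/adjC//|->]]; by move/adjxx.
  by split; [right; right|left|apply/Nc].
Qed.

Lemma priv_induced G (G' : graph U) X r x : induced_subgraph G G' -> X `<=` vert G ->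
  vert G x -> priv G X r x <-> priv G' X r x.
Proof.
move=> [vG iG] XG Gx; split=> -[G'x nXx Nx]; split=> //; try exact: vG.
  by move=> v Xv; rewrite -iG//; [exact: Nx|exact: XG].
by move=> v Xv; rewrite iG//; [exact: Nx|exact: XG].
Qed.

Lemma ext_pair_induced G (G' : graph U) X s t a c : induced_subgraph G G' ->
  X `<=` vert G -> vert G a -> vert G c ->
  ext_pair G X s t a c <-> ext_pair G' X s t a c.
Proof.
move=> GG' XG Ga Gc; split=> -[pa pc ac nac]; split=> //;
  try exact/(priv_induced _ GG').
  by apply: contra_not nac => ?; apply/(GG'.2 _ _ Ga Gc).
by apply: contra_not nac => ?; apply/(GG'.2 _ _ Ga Gc).
Qed.

(* Structural form of a pendant extension: the new vertices are those of
   [a], [c] that are not already in [G]. *)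
Definition pe_pair G X s t (G' : graph U) a c : Prop :=
  [/\ ext_pair G' X s t a c /\ vert G' = vert G `|` [set a; c],
      ~ (vert G a /\ vert G c),
      ~ vert G a -> forall v, adj G' a v <-> v = s,
      ~ vert G c -> forall v, adj G' c v <-> v = t
    & ~ vert G a -> ~ vert G c ->
        forall x, ~ priv G X s x /\ ~ priv G X t x].

Definition pe_step G X s t (G' : graph U) : Prop :=
  [/\ no_ext G X s t, induced_subgraph G G' & exists a c, pe_pair G X s t G' a c].

(** Minimality is exploited by deleting new vertices: a part of them that still carries an extension
    must be all of them. *)
Lemma pendant_extension_step G H (G' : graph U) : induced_subgraph H G ->
  ~ has_extension G H -> pendant_extension G H G' ->
  pe_step G (vert H) (root_s H) (root_t H) G'.
Proof.
move=> HG simp [k [[W [Wk WG vG' iGG' NW]] extG' mink]].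
have Hs := root_s_vert H; have Ht := root_t_vert H.
have HG' := induced_trans HG iGG'.
have noext : no_ext G (vert H) (root_s H) (root_t H).
  by move=> a c e; apply: simp; apply/has_extP => //; exists a, c.
have nW x : W x -> ~ vert G x.
  by move=> Wx Gx; have : (W `&` vert G) x by []; rewrite WG.
have finW : finite_set W by exists k.
(* The competitor is the subgraph of [G'] induced on [vert G] and [W1]. Minimality makes [W] no
   larger than its subset [W1]. *)
have minW a c W1 : W1 `<=` W ->
    ext_pair G' (vert H) (root_s H) (root_t H) a c ->
    (vert G `|` W1) a -> (vert G `|` W1) c -> W `<=` W1.
  move=> W1W e Va Vc; apply: finite_subset_full => //.
  have [k1 W1k] : finite_set W1 by exact: sub_finite_set finW.
  rewrite (card_le_eql Wk) (card_le_eqr W1k) card_le_II.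
  have VG' : vert G `|` W1 `<=` vert G'.
    by rewrite vG' => x [|/W1W]; [left|right].
  have iV := induced_graph_of VG'.
  have iG : induced_subgraph G (graph_of (vert G `|` W1) (adj G')).
    split=> [x|x y Gx Gy]; first by left.
    rewrite iGG'.2// adj_graph_of_sub//; split=> [?|[]//].
    by split=> //; left.
  apply: (mink _ (graph_of (vert G `|` W1) (adj G'))).
    exists W1; split=> //.
      by rewrite -subset0 => x [/W1W/nW].
    move=> w W1w; have [r rst Nr] := NW _ (W1W _ W1w).
    exists r => // v; rewrite adj_graph_of_sub//; split=> [[_ _ /Nr]//|->].
    split; [by right| |exact/Nr].
    by left; apply: HG.1; case: rst => ->.
  apply/has_extP; first exact: induced_trans iG.
  by exists a, c; apply/(ext_pair_induced _ _ iV) => // x /HG.1; left.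
split=> //.
have [a [c e]] := (has_extP HG').1 extG'.
exists a, c.
have [pa pc ac nac] := e.
have [G'a nHa Na] := pa; have [G'c nHc Nc] := pc.
have Wac x : W x -> x = a \/ x = c.
  have := @minW a c (W `&` [set a; c]) (@subIsetl _ _ _) e.
  move=> /[swap] Wx h; have [||_ //] := h _ _ x Wx.
    by move: G'a; rewrite vG' => -[|Wa]; [left|right; split=> //; left].
  by move: G'c; rewrite vG' => -[|Wc]; [left|right; split=> //; right].
have GW x : vert G' x -> ~ vert G x -> W x by rewrite vG' => -[].
have root_of w r : W w -> vert H r -> adj G' w r -> forall v, adj G' w v <-> v = r.
  move=> /NW[r' _ Nr'] Hr /Nr' e'; by move=> v; rewrite Nr' e'.
have Na' : ~ vert G a -> forall v, adj G' a v <-> v = root_s H.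
  by move=> nGa; apply: root_of => //; [exact: GW | apply/Na].
have Nc' : ~ vert G c -> forall v, adj G' c v <-> v = root_t H.
  by move=> nGc; apply: root_of => //; [exact: GW | apply/Nc].
split=> //.
- split=> //; apply/seteqP; split=> x; rewrite vG' => -[]; try by left.
    by move=> /Wac; right.
  by move=> [] ->; [move: G'a|move: G'c]; rewrite vG'.
- by move=> [Ga Gc]; apply: (noext a c); exact: (ext_pair_induced _ _ iGG' HG.1 Ga Gc).2.
(* When both are new, a vertex [x] of [G] private for one root could replace the one attached there,
   leaving a single new vertex. *)
- move=> nGa nGc x; have [Wa Wc] := (GW _ G'a nGa, GW _ G'c nGc).
  split=> px; have [Gx nHx Nx] := px.
    have px' := (priv_induced (root_s H) iGG' HG.1 Gx).1 px.
    have e' : ext_pair G' (vert H) (root_s H) (root_t H) x c.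
      split=> //; first by move=> xc; apply: nGc; rewrite -xc.
      by move=> /adjC/Nc' => /(_ nGc) xt; apply: nHx; rewrite xt.
    have Wc' : [set c] `<=` W by move=> _ ->.
    exact: ac (minW _ _ _ Wc' e' (or_introl Gx) (or_intror erefl) a Wa).
  have px' := (priv_induced (root_t H) iGG' HG.1 Gx).1 px.
  have e' : ext_pair G' (vert H) (root_s H) (root_t H) a x.
    split=> //; first by move=> ax; apply: nGa; rewrite ax.
    by move=> /Na' => /(_ nGa) xt; apply: nHx; rewrite xt.
  have Wa' : [set a] `<=` W by move=> _ ->.
  have := minW _ _ _ Wa' e' (or_intror erefl) (or_introl Gx) c Wc.
  by move/esym/ac.
Qed.

(** One pendant edge is unavoidable because [G] has no extension, and two are when neither root has
    a private vertex in [G]; the structural form adds no more than that. *)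
Lemma step_pendant_extension G H (G' : graph U) : induced_subgraph H G ->
  pe_step G (vert H) (root_s H) (root_t H) G' -> pendant_extension G H G'.
Proof.
move=> HG [noext iGG' [a [c [[e vG'] nGac Na Nc nopriv]]]].
have HG' := induced_trans HG iGG'.
have ac : a <> c by case: e.
pose W := [set a; c] `\` vert G.
have finW : finite_set W by apply: finite_setD; exact: finite_set2.
have [k Wk] := finW.
exists k; split.
- exists W; split=> //.
  + by rewrite -subset0 => x [[_ nGx]].
  + rewrite vG'; apply/seteqP; split=> x [Gx|Wx]; try by left.
      by have [Gx|nGx] := pselect (vert G x); [left|right].
    by right; case: Wx.
  + move=> w [[->|->] nGw]; first by exists (root_s H); [left|exact: Na].
    by exists (root_t H); [right|exact: Nc].
- by apply/has_extP => //; exists a, c.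
move=> k' G'' [W' [W'k' W'G vG'' iGG'' N']] extG''.
have HG'' := induced_trans HG iGG''.
have [a' [c' e']] := (has_extP HG'').1 extG''.
have [pa pc ac' _] := e'.
have inW' x : vert G'' x -> ~ vert G x -> W' x by rewrite vG'' => -[].
have [G''a _ _] := pa; have [G''c _ _] := pc.
rewrite -card_le_II -(card_le_eql Wk) -(card_le_eqr W'k').
(* An extension in [G''] involves some new vertex, which suffices when only one of [a], [c] is
   new. *)
have [x W'x] : exists x, W' x.
  have [Ga|/inW' W'a] := pselect (vert G a'); last by exists a'; exact: W'a.
  have [Gc|/inW' W'c] := pselect (vert G c'); last by exists c'; exact: W'c.
  by case: (noext a' c'); exact: (ext_pair_induced _ _ iGG'' HG.1 Ga Gc).2.
have [Ga|nGa] := pselect (vert G a).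
  apply: (@injection_card_le _ _ _ _ (fun _ => x)) => //.
  by move=> _ _ [[->|->] + ] [[->|->] + ] _.
have [Gc|nGc] := pselect (vert G c).
  apply: (@injection_card_le _ _ _ _ (fun _ => x)) => //.
  by move=> _ _ [[->|->] + ] [[->|->] + ] _.
have [W'a W'c] : W' a' /\ W' c'.
  split; apply: inW' => // Gx.
    apply: (nopriv nGa nGc a').1.
    exact: (priv_induced _ iGG'' HG.1 Gx).2.
  apply: (nopriv nGa nGc c').2.
  exact: (priv_induced _ iGG'' HG.1 Gx).2.
pose f x := if pselect (x = a) is left _ then a' else c'.
apply: (@injection_card_le _ _ _ _ f) => [y _|y z].
  by rewrite /f; case: pselect.
rewrite /f => -[yac _] [zac _]; case: pselect => ya; case: pselect => za //.
- by rewrite ya za.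
- by move=> e'c; case: ac'.
- by move=> _; case: yac => [/ya//|->]; case: zac => [/za//|->].
Qed.

(** One formula serves for one or two new vertices: the guard [~ vert G x] adds edges only at those
    of [a], [c] that lie outside [G]. *)
Lemma attach_step G X s t a c : X `<=` vert G -> X s -> X t ->
  no_ext G X s t -> a <> c ->
  (vert G a -> priv G X s a) -> (vert G c -> priv G X t c) ->
  ~ (vert G a /\ vert G c) ->
  (~ vert G a -> ~ vert G c -> forall x, ~ priv G X s x /\ ~ priv G X t x) ->
  pe_step G X s t (graph_of (vert G `|` [set a; c]) (fun x y => adj G x y \/
     ~ vert G x /\ (x = a /\ y = s \/ x = c /\ y = t))).
Proof.
set G' := graph_of _ _ => XG Xs Xt noext ac pa pc nGac nopriv.
have [Gs Gt] := (XG _ Xs, XG _ Xt).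
have iGG' : induced_subgraph G G'.
  split=> [x|x y Gx Gy]; first by left.
  split=> [Gxy|[_ _ _ [[//|[]//]|[/adjC//|[]//]]]].
  by split; [left|left|exact: adj_neq Gxy|left; left].
have Na : ~ vert G a -> forall v, adj G' a v <-> v = s.
  move=> nGa v; split=> [[_ _ _]|->].
    case=> [[/adj_vert1//|[_ [[]//|[]//]]]|[/adj_vert2//|]].
    by move=> [_ [[_ as_]|[_ at_]]]; case: nGa; rewrite ?as_ ?at_.
  split; [by right; left|by left|by move=> as_; apply: nGa; rewrite as_|].
  by left; right; split=> //; left.
have Nc : ~ vert G c -> forall v, adj G' c v <-> v = t.
  move=> nGc v; split=> [[_ _ _]|->].
    case=> [[/adj_vert1//|[_ [[]/esym//|[]//]]]|[/adj_vert2//|]].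
    by move=> [_ [[_ as_]|[_ at_]]]; case: nGc; rewrite ?as_ ?at_.
  split; [by right; right|by left|by move=> as_; apply: nGc; rewrite as_|].
  by left; right; split=> //; right.
have pa' : priv G' X s a.
  have [Ga|nGa] := pselect (vert G a).
    by apply/(priv_induced _ iGG' XG Ga); exact: pa.
  split; [by right; left|by move=> /XG|by move=> v _; exact: Na].
have pc' : priv G' X t c.
  have [Gc|nGc] := pselect (vert G c).
    by apply/(priv_induced _ iGG' XG Gc); exact: pc.
  split; [by right; right|by move=> /XG|by move=> v _; exact: Nc].
split=> //; exists a, c; split=> //; split=> //; split=> // G'ac.
have [Ga|nGa] := pselect (vert G a).
  have [Gc|nGc] := pselect (vert G c); first exact: nGac.
  have [_ nXa _] := pa Ga.
  by move: G'ac => /adjC/(Nc nGc) e; apply: nXa; rewrite e.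
have [_ nXc _] := pc'.
by move: G'ac => /(Na nGa) e; apply: nXc; rewrite e.
Qed.

(** If some root has a private vertex, it is kept and one fresh vertex is attached at the other
    root; otherwise two are attached. The reservoir [N] later keeps fresh vertices away from a given
    limit. *)
Lemma pe_step_exists G X N s t : finite_set (vert G) -> infinite_set N ->
  X `<=` vert G -> X s -> X t -> no_ext G X s t ->
  exists G', pe_step G X s t G' /\ vert G' `<=` vert G `|` N.
Proof.
move=> finG infN XG Xs Xt noext.
have [n1 [Nn1 nGn1]] := infinite_setN0 (infinite_setD infN finG).
have fin1 : finite_set (vert G `|` [set n1]) by rewrite finite_setU.
have [n2 [Nn2 n2G]] := infinite_setN0 (infinite_setD infN fin1).
have nGn2 : ~ vert G n2 by move=> ?; apply: n2G; left.
have n21 : n2 <> n1 by move=> ?; apply: n2G; right.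
suff [a [c [ac pa pc [nGac nopriv [Na Nc]]]]] : exists a c, [/\ a <> c,
    vert G a -> priv G X s a, vert G c -> priv G X t c &
    [/\ ~ (vert G a /\ vert G c), (~ vert G a -> ~ vert G c ->
      forall x, ~ priv G X s x /\ ~ priv G X t x) &
      (vert G `|` N) a /\ (vert G `|` N) c]].
  eexists; split; first exact: (attach_step XG Xs Xt noext ac).
  by move=> x /= [Gx|[->|->]//]; left.
have [[x px]|nos] := pselect (exists x, priv G X s x).
  have [Gx _ _] := px.
  exists x, n1; split=> //; first by move=> xn; apply: nGn1; rewrite -xn.
  by split=> //; [case|by split; [left|right]].
have [[x px]|not_] := pselect (exists x, priv G X t x).
  have [Gx _ _] := px.
  exists n1, x; split=> //; first by move=> xn; apply: nGn1; rewrite xn.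
  by split=> //; [case|by split; [right|left]].
exists n2, n1; split=> //; split=> //; first by case.
  by move=> _ _ x; split=> px; [apply: nos|apply: not_]; exists x.
by split; right.
Qed.

Lemma ext_pair_swap G X s t a c : ext_pair G X s t a c -> ext_pair G X t s c a.
Proof.
by move=> [pa pc ac nac]; split=> //; [exact/nesym|move=> /adjC].
Qed.

Lemma pe_pair_swap G X s t G' a c : pe_pair G X s t G' a c -> pe_pair G X t s G' c a.
Proof.
move=> [[/ext_pair_swap e vG'] nGac Na Nc nopriv]; split=> //.
- by split=> //; rewrite vG' (setUC [set c]).
- by move=> [Gc Ga]; exact: nGac.
- by move=> nc na x; case: (nopriv na nc x).
Qed.

(** This symmetry lets a vertex attached at [t] be treated as one attached at [s]. *)
Lemma pe_step_swap G X s t G' : pe_step G X s t G' -> pe_step G X t s G'.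
Proof.
move=> [noext iGG' [a [c pe]]]; split=> //.
  by move=> a' c' /ext_pair_swap; exact: noext.
by exists c, a; exact: pe_pair_swap.
Qed.

Lemma finite_step G X s t G' : finite_set (vert G) -> pe_step G X s t G' ->
  finite_set (vert G').
Proof.
move=> finG [_ _ [a [c [[_ ->] _ _ _ _]]]].
by rewrite finite_setU; split=> //; exact: finite_set2.
Qed.

End Basics.

(** * Chains of pendant extensions and their limits *)

Section Chains.
Variables (U : Type) (Hh : two_rooted U).
Implicit Types (g : nat -> graph U) (H : two_rooted U).

(* A PE-sequence in which steps may also be idle; idle steps turn finite
   PE-sequences into infinite chains. *)
Definition chain g : Prop := g 0%N = Hh /\ forall i, g i.+1 = g i \/
  exists H, is_copy Hh (g i) H /\
    pe_step (g i) (vert H) (root_s H) (root_t H) (g i.+1).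

Definition limit g : graph U := limit_graph (fun i => Some (g i)).

Definition born g i x := vert (g i.+1) x /\ ~ vert (g i) x.

Definition parent g x p := exists i, born g i x /\ adj (g i.+1) x p.

Section Chain.
Variables (g : nat -> graph U) (cg : chain g).

Lemma chain_induced_add i k : induced_subgraph (g i) (g (i + k)).
Proof.
elim: k => [|k IH]; first by rewrite addn0; exact: induced_refl.
apply: (induced_trans IH); rewrite addnS.
case: (cg.2 (i + k)) => [->|[H [_ []]]] //; exact: induced_refl.
Qed.

Lemma chain_induced i j : (i <= j)%N -> induced_subgraph (g i) (g j).
Proof. by move=> /subnKC <-; exact: chain_induced_add. Qed.

Lemma chain_mono i j x : (i <= j)%N -> vert (g i) x -> vert (g j) x.
Proof. by move=> /chain_induced[h _]; exact: h. Qed.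

Lemma chain_base x : vert (g 0%N) x <-> vert Hh x.
Proof. by rewrite cg.1. Qed.

Lemma chain_finite i : finite_set (vert (g i)).
Proof.
elim: i => [|i IH]; first by rewrite cg.1; exact: tr_finite.
by case: (cg.2 i) => [->//|[H [_]]]; exact: finite_step.
Qed.

(** A vertex is a leaf at birth; the tree structure outside the base rests on this. *)
Lemma chain_new i x : born g i x ->
  exists2 r, vert (g i) r & forall v, adj (g i.+1) x v <-> v = r.
Proof.
move=> [gx ngx]; case: (cg.2 i) => [e|[H [[[HG _] _] [_ _]]]].
  by case: ngx; rewrite -e.
move=> [a [c [[_ e] _ Na Nc _]]].
move: gx; rewrite e => -[//|[xa|xc]].
  exists (root_s H); first exact/HG/root_s_vert.
  by rewrite xa; apply: Na; rewrite -xa.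
exists (root_t H); first exact/HG/root_t_vert.
by rewrite xc; apply: Nc; rewrite -xc.
Qed.

Lemma limit_vertP x : vert (limit g) x <-> exists i, vert (g i) x.
Proof.
split=> [[i [G [[<-] Gx]]]|[i gx]]; first by exists i.
by exists i, (g i).
Qed.

Lemma limit_induced i : induced_subgraph (g i) (limit g).
Proof.
split=> [x gx|x y gx gy]; first by apply/limit_vertP; exists i.
split=> [gxy|[j [G [[<-] Gxy]]]]; first by exists i, (g i).
have [ij|/ltnW ji] := leqP i j.
  exact/((chain_induced ij).2 _ _ gx gy).
by apply/((chain_induced ji).2) => //; [exact: adj_vert Gxy | exact: adj_vert2 Gxy].
Qed.

(** The stages increase, so the largest of finitely many entry stages contains everything. *)
Lemma limit_finite (X : set U) : finite_set X -> X `<=` vert (limit g) ->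
  exists i, X `<=` vert (g i).
Proof.
move=> finX XL.
have /choice[h hX] : forall x, exists i, X x -> vert (g i) x.
  move=> x; have [/XL/limit_vertP[i gx]|nXx] := pselect (X x); last by exists 0%N.
  by exists i.
have /finite_seqP[s es] := finite_image h finX.
exists (\max_(i <- s) i)%N => x Xx; apply: chain_mono (hX x Xx).
apply: (@leq_bigmax_seq _ s xpredT id) => //.
have : (h @` X) (h x) by exists x.
by rewrite es.
Qed.

Lemma bornP x : vert (limit g) x -> vert Hh x \/ exists i, born g i x.
Proof.
move=> /limit_vertP[i]; elim: i => [|i IH] gx; first by left; apply/chain_base.
have [/IH//|ngx] := pselect (vert (g i) x); by right; exists i.
Qed.

Lemma born_base i x : born g i x -> ~ vert Hh x.
Proof.
move=> [_ ngx] Hx; apply: ngx; apply: (chain_mono (leq0n i)).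
exact/chain_base.
Qed.

Lemma born_after i j x : born g i x -> vert (g j) x -> (i < j)%N.
Proof.
move=> [_ ngx] gx; rewrite ltnNge; apply/negP => ji.
by apply: ngx; exact: chain_mono gx.
Qed.

Lemma born_uniq i j x : born g i x -> born g j x -> i = j.
Proof.
move=> bi bj; have := born_after bi bj.1; have := born_after bj bi.1.
by rewrite !ltnS => ji ij; apply/eqP; rewrite eqn_leq ij.
Qed.

Lemma born_parent i x : born g i x -> exists r, [/\ parent g x r, vert (g i) r
  & forall v, vert (g i.+1) v -> adj (limit g) x v <-> v = r].
Proof.
move=> bx; have [r gr Nr] := chain_new bx; exists r; split=> //.
  by exists i; split=> //; exact/Nr.
by move=> v gv; rewrite -(limit_induced i.+1).2//; exact: bx.1.
Qed.

Lemma parent_born i x p : parent g x p -> born g i x ->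
  [/\ vert (g i) p, adj (limit g) x p
    & forall v, vert (g i.+1) v -> adj (limit g) x v -> v = p].
Proof.
move=> [j [bj xp]] bi; rewrite -(born_uniq bj bi).
have [r gr Nr] := chain_new bj; have pr := (Nr _).1 xp; rewrite pr.
split=> //; first by exists j.+1, (g j.+1); split=> //; exact/Nr.
by move=> v gv; rewrite -(limit_induced j.+1).2 ?Nr//; exact: bj.1.
Qed.

Lemma parent_uniq x p q : parent g x p -> parent g x q -> p = q.
Proof.
move=> xp [i [bi xq]]; have [_ _ h] := parent_born xp bi.
by symmetry; apply: h; [exact: adj_vert2 xq | exists i.+1, (g i.+1)].
Qed.

Lemma parent_adj x p : parent g x p -> adj (limit g) x p.
Proof. by move=> [i [_ gxp]]; exists i.+1, (g i.+1). Qed.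

Lemma parent_base x p : parent g x p -> ~ vert Hh x.
Proof. by move=> [i [bx _]]; exact: born_base bx. Qed.

Lemma parent_asym x p : parent g x p -> ~ parent g p x.
Proof.
move=> xp [i [bp px]]; have [j [bx _]] := xp.
have [gp _ _] := parent_born xp bx.
have [gx _ _] := @parent_born i p x (ex_intro _ i (conj bp px)) bp.
have := born_after bx gx; rewrite ltnNge => /negP; apply.
by apply/ltnW; exact: born_after bp gp.
Qed.

Lemma born_adj_parent i x y : born g i x -> adj (limit g) x y ->
  vert (g i.+1) y -> parent g x y.
Proof.
by move=> bx xy gy; have [r [xr _ /(_ y gy)[h _]]] := born_parent bx; rewrite (h xy).
Qed.

(** Of two adjacent vertices, the one born last has only its parent as a neighbour at birth. *)
Lemma adj_parent x y : adj (limit g) x y ->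
  (vert Hh x /\ vert Hh y) \/ parent g x y \/ parent g y x.
Proof.
move=> xy; have yx := adj_sym xy.
have g0 i z : vert Hh z -> vert (g i) z.
  by move=> Hz; apply: (chain_mono (leq0n i)); apply/chain_base.
have [Hx|[i bx]] := bornP (adj_vert xy).
  have [Hy|[j by_]] := bornP (adj_vert yx); first by left.
  by right; right; apply: (born_adj_parent by_ yx); exact: g0.
have [Hy|[j by_]] := bornP (adj_vert yx).
  by right; left; apply: (born_adj_parent bx xy); exact: g0.
have [ij|/ltnW ji] := leqP i j; right; [right|left].
  by apply: (born_adj_parent by_ yx); apply: chain_mono bx.1.
by apply: (born_adj_parent bx xy); apply: chain_mono by_.1.
Qed.

End Chain.

End Chains.

(** * The 2-core of a limit *)

Section Core.
Variables (U : Type) (Hh : two_rooted U).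
Implicit Types (G : graph U) (X : set U).

(** A shortest walk never turns back: two steps could be cut out of a walk with [w i = w i.+2]. *)
Lemma tight_walk (R : U -> U -> Prop) x y : clos_refl_trans U R x y ->
  exists n (w : nat -> U), [/\ w 0%N = x, w n = y,
    forall i, (i < n)%N -> R (w i) (w i.+1)
    & forall i, (i.+1 < n)%N -> w i <> w i.+2].
Proof.
move=> /Operators_Properties.clos_rt_rt1n_iff Rxy.
pose P n := exists w : nat -> U, [/\ w 0%N = x, w n = y &
  forall i, (i < n)%N -> R (w i) (w i.+1)].
have exP : exists n, `[< P n >].
  elim: Rxy @P => {x y} [x|x y z Rxy _ [n /asboolP[w [w0 wn Rw]]]] P.
    by exists 0%N; apply/asboolP; exists (fun _ => x).
  exists n.+1; apply/asboolP.
  exists (fun i => if i is j.+1 then w j else x); split=> // -[_|i].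
    by rewrite w0.
  exact: Rw.
case: (ex_minnP exP) => n /asboolP[w [w0 wn Rw]] minn.
exists n, w; split=> // i ltin wii.
suff : (n <= n - 2)%N by lia.
apply: minn; apply/asboolP.
exists (fun j => if (j < i)%N then w j else w j.+2); split=> /=.
- by case: i wii {ltin} => [|i] //= <-.
- case: ltnP => [lt2|_].
    by lia.
  by rewrite -wn; congr w; lia.
- move=> j ltj; case: (ltnP j i) => ji.
    case: ltnP => ji'; first by apply: Rw; lia.
    have -> : j.+1 = i by lia.
    rewrite -wii; have -> : i = j.+1 by lia.
    by apply: Rw; lia.
  by case: ltnP => ji'; [lia | apply: Rw; lia].
Qed.

(** In a finite graph the union of these sets is the 2-core. *)
Definition mindeg2 G X : Prop :=
  [/\ finite_set X, X `<=` vert G & forall x, X x ->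
      exists y z, [/\ X y, X z, y <> z, adj G x y & adj G x z]].

Lemma mindeg2_induced G G' X : induced_subgraph G G' -> X `<=` vert G ->
  mindeg2 G X <-> mindeg2 G' X.
Proof.
move=> [vG iG] XG; split=> -[finX _ dX]; split=> //.
- exact: subset_trans vG.
- move=> x Xx; have [y [z [Xy Xz yz xy xz]]] := dX x Xx; exists y, z.
  by split=> //; apply/iG => //; exact: XG.
- move=> x Xx; have [y [z [Xy Xz yz xy xz]]] := dX x Xx; exists y, z.
  by split=> //; apply/iG => //; exact: XG.
Qed.

Lemma mindeg2_image G G' f X : graph_iso G G' f -> mindeg2 G X ->
  mindeg2 G' (f @` X).
Proof.
move=> [[fG fI _] fadj] [finX XG dX]; split.
- exact: finite_image.
- by move=> _ [x Xx <-]; apply: fG; exact: XG.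
move=> _ [x Xx <-]; have [y [z [Xy Xz yz xy xz]]] := dX x Xx.
exists (f y), (f z); split; try by exists y.
- by exists z.
- by move=> e; apply: yz; apply: fI => //; rewrite inE; exact: XG.
- by apply/fadj => //; exact: XG.
- by apply/fadj => //; exact: XG.
Qed.

Variables (g : nat -> graph U) (cg : chain Hh g).

(** A last-born vertex of [X] outside the base would have two distinct parents. *)
Lemma mindeg2_base X : mindeg2 (limit g) X -> X `<=` vert Hh.
Proof.
move=> [finX XL dX]; have [i] := limit_finite cg finX XL.
elim: i => [|i IH] Xg; first by move=> x /Xg /(chain_base cg).
apply: IH => x Xx; apply: contrapT => ngx.
have bx : born g i x by split=> //; exact: Xg.
have [y [z [Xy Xz yz xy xz]]] := dX x Xx.
have xy' := born_adj_parent cg bx xy (Xg _ Xy).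
have xz' := born_adj_parent cg bx xz (Xg _ Xz).
exact: yz (parent_uniq cg xy' xz').
Qed.

(* The limit has no subgraph of minimum degree 2 outside the base, so a copy of
   the base contains the whole 2-core; if [a] and [c] were adjacent, they would
   close up a walk from [s] to [t] in the copy and lie in the 2-core too. *)
Lemma connected_priv_nonadj H a c :
  clos_refl_trans U (adj Hh) (root_s Hh) (root_t Hh) ->
  is_copy Hh (limit g) H -> root_s H <> root_t H ->
  priv (limit g) (vert H) (root_s H) a -> priv (limit g) (vert H) (root_t H) c ->
  ~ adj (limit g) a c.
Proof.
move=> walk [HL [f [fiso fs ft]]] st [La nHa Na] [Lc nHc Nc] ac.
have [[fH fI fS] fadj] := fiso.
have [Hs Ht] := (root_s_vert H, root_t_vert H).
have [n [w [w0s wnt Rw nback]]] := tight_walk walk.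
have Hw i : (i <= n)%N -> vert Hh (w i).
  rewrite leq_eqVlt => /orP[/eqP->|/Rw h]; last exact: adj_vert h.
  by rewrite wnt; exact: root_t_vert.
have n0 : (0 < n)%N.
  by case: n w0s wnt {Rw nback Hw} => // w0s wnt; case: st; rewrite -fs -ft -w0s wnt.
have Lfw i : (i <= n)%N -> vert H (f (w i)) by move=> /Hw; exact: fH.
have Ladj i : (i < n)%N -> adj (limit g) (f (w i)) (f (w i.+1)).
  move=> lin; apply/(HL.2 _ _ _ _); rewrite -?fadj; try exact: Lfw; try exact: Hw.
  - by apply: Lfw; lia.
  - exact: Rw.
  - by apply: Hw; lia.
(* The image of the walk between the roots, closed up through [a] and [c]. As the walk never turns
   back, the two neighbours of an inner vertex are distinct. *)
pose X := [set f (w i) | i in `I_n.+1] `|` [set a; c].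
have Xw i : (i <= n)%N -> X (f (w i)) by move=> lin; left; exists i.
have [Xa Xc] : X a /\ X c by split; right; [left|right].
have as_ : adj (limit g) a (root_s H) by apply/Na.
have ct : adj (limit g) c (root_t H) by apply/Nc.
have Xs : X (root_s H) by rewrite -fs -w0s; exact: Xw.
have Xt : X (root_t H) by rewrite -ft -wnt; exact: Xw.
have ne x y : vert H x -> ~ vert H y -> x <> y by move=> Hx nHy e; apply: nHy; rewrite -e.
have X2 : mindeg2 (limit g) X.
  split.
  - by rewrite finite_setU; split; [exact: finite_image|exact: finite_set2].
  - by move=> x [[i lin <-]|[->//|->//]]; apply/HL.1/Lfw.
  move=> x [[i lin <-]|[->|->]]; last 2 first.
  - by exists (root_s H), c; split=> //; exact: ne.
  - exists (root_t H), a; split=> //; [exact: ne|exact: adjC].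
  have {}lin : (i <= n)%N := lin.
  have [i0|i0] := posnP i.
    exists a, (f (w 1%N)); split=> //; first exact: Xw.
    - by apply/nesym/ne => //; exact: Lfw.
    - by rewrite i0 w0s fs; exact: adjC.
    - by rewrite i0; exact: Ladj.
  have e : i = i.-1.+1 by rewrite prednK.
  have im : adj (limit g) (f (w i)) (f (w i.-1)).
    by apply: adjC; rewrite {2}e; apply: Ladj; lia.
  have [ein|ltin] := eqVneq i n.
    exists c, (f (w i.-1)); split=> //.
    - by apply: Xw; lia.
    - by apply/nesym/ne => //; apply: Lfw; lia.
    - by rewrite ein wnt ft; exact: adjC.
  exists (f (w i.-1)), (f (w i.+1)); split=> //.
  - by apply: Xw; lia.
  - by apply: Xw; lia.
  - move=> /fI; rewrite !inE => h; apply: (nback i.-1); first by lia.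
    by rewrite -e; apply: h; apply: Hw; lia.
  - by apply: Ladj; lia.
(* The map [f] sends the 2-core [C] of the base injectively into itself, hence onto it. As [a] lies
   in [C], it would be a vertex of the copy. *)
pose C : set U := [set x | exists2 X, mindeg2 Hh X & X x].
have core Y : mindeg2 (limit g) Y -> mindeg2 Hh Y.
  move=> Y2; have YH := mindeg2_base Y2.
  have HhL : induced_subgraph Hh (limit g).
    by rewrite -cg.1; exact: (limit_induced cg 0%N).
  exact: (mindeg2_induced HhL YH).2 Y2.
have CH x : C x -> vert Hh x by move=> [Y [_ YH _] /YH].
have [|x Cx|x y Cx Cy||x Cx fxa] := @finite_injection_onto _ C f _ _ _ a.
- exact: sub_finite_set CH (tr_finite Hh).
- case: Cx => Y Y2 Yx; exists (f @` Y); last by exists x.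
  apply: core; have := mindeg2_image fiso Y2.
  have [_ YH _] := Y2; have fYH : f @` Y `<=` vert H.
    by move=> _ [y /YH Hy <-]; exact: fH.
  exact: (mindeg2_induced HL fYH).1.
- by apply: fI; rewrite inE; exact: CH.
- by exists X => //; exact: core.
by apply: nHa; rewrite -fxa; apply/fH/CH.
Qed.

End Core.

(** * Uniqueness of proper limits *)

Section Uniqueness.
Variables (U : Type) (Hh : two_rooted U).
Implicit Types (g h : nat -> graph U) (A : set U) (P Q : set (U * U)).

Lemma copy_image G G' H (f : U -> U) : is_copy Hh G H ->
  (forall x, vert H x -> vert G' (f x)) ->
  (forall x y, vert H x -> vert H y -> f x = f y -> x = y) ->
  (forall x y, vert H x -> vert H y -> adj G x y <-> adj G' (f x) (f y)) ->
  exists H', [/\ is_copy Hh G' H', vert H' = f @` vert H,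
    root_s H' = f (root_s H) & root_t H' = f (root_t H)].
Proof.
move=> [HG [k [[[kH kI kS] kadj] ks kt]]] fG fI fadj.
have V'G' : f @` vert H `<=` vert G' by move=> _ [x Hx <-]; exact: fG.
pose H' := @TwoRooted U (graph_of (f @` vert H) (adj G')) _ _
  (finite_image f (tr_finite H)) (imageP f (root_s_vert H))
  (imageP f (root_t_vert H)).
exists H'; split=> //; split; first exact: induced_graph_of.
exists (f \o k); split=> /=; rewrite ?ks ?kt//; split; first split.
- by move=> x Hx; exists (k x) => //; exact: kH.
- move=> x y; rewrite !inE => Hx Hy /fI e; apply: kI; rewrite ?inE//.
  by apply: e; exact: kH.
- by move=> _ [x Hx <-]; have [y Hy <-] := kS x Hx; exists y.
move=> x y Hx Hy; rewrite kadj// HG.2 ?fadj; try exact: kH.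
split=> [kxy|/adj_graph_of_sub[]//].
apply/adj_graph_of_sub; split=> //.
  by exists (k x) => //; exact: kH.
by exists (k y) => //; exact: kH.
Qed.

Definition older g z x := exists i j, [/\ born g i z, born g j x & (i < j)%N].

Definition sibling_closed g A := forall x p, A x -> parent g x p ->
  A p /\ forall z, parent g z p -> older g z x -> A z.

Definition dom P : set U := [set x | exists y, P (x, y)].
Definition ran P : set U := [set y | exists x, P (x, y)].

(* Closure under parents and older siblings is what lets a partial isomorphism
   be extended by matching the oldest available children of matched vertices. *)
Definition partial_iso g h P := [/\ 
  forall x y, P (x, y) -> vert (limit g) x /\ vert (limit h) y,
  forall x y x' y', P (x, y) -> P (x', y') ->
    (x = x' <-> y = y') /\ (adj (limit g) x x' <-> adj (limit h) y y'),
  forall x, vert Hh x -> P (x, x),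
  sibling_closed g (dom P) & sibling_closed h (ran P)].

Lemma partial_iso_flip g h P : partial_iso g h P ->
  partial_iso h g [set p | P (p.2, p.1)].
Proof.
move=> [PL Piso PH Pd Pr]; split=> //.
- by move=> x y /PL[].
- by move=> x y x' y' p p'; have [] := Piso _ _ _ _ p p'; split; split; tauto.
Qed.

(** A child of [w] inside [A] would bring [w] into [A] by closure under parents. *)
Lemma outside_adj g A w r x : chain Hh g -> vert Hh `<=` A ->
  sibling_closed g A -> ~ A w -> parent g w r -> A x ->
  adj (limit g) w x <-> x = r.
Proof.
move=> cg HA cA nAw wr Ax; split=> [|->]; last exact: parent_adj.
case/(adj_parent cg) => [[/HA//]|[/(parent_uniq cg wr)//|]].
by move=> /(cA _ _ Ax)[].
Qed.

(** Suppose all neighbours of [s'] are matched. A vertex private for [s'] then pulls back to one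
    private for [s] in [limit g], which lies in [g i] or equals [c]. Such pullbacks contradict
    either [no_ext] or the minimality of the step. *)
Lemma copy_candidate g h P i X s t s' t' a c a' c' f :
  chain Hh g -> chain Hh h -> partial_iso g h P ->
  vert (g i) `<=` dom P -> X `<=` vert (g i) -> X s -> X t ->
  no_ext (g i) X s t -> pe_pair (g i) X s t (g i.+1) a c ->
  born g i a -> ~ dom P a ->
  (s <> t -> forall x y, priv (limit g) X s x -> priv (limit g) X t y ->
    ~ adj (limit g) x y) ->
  (forall x, X x -> P (x, f x)) -> s' = f s -> t' = f t ->
  ext_pair (limit h) (f @` X) s' t' a' c' ->
  exists y, ~ ran P y /\ adj (limit h) y s'.
Proof.
move=> cg ch [PL Piso PH Pd Pr] gP Xg Xs Xt noext
  [[e vg'] _ Na Nc nopriv] ba nPa F Pf s'f t'f [pa' pc' ac' nac'].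
apply: contrapT => NC.
have cand y : adj (limit h) y s' -> ran P y.
  by move=> ys; apply: contrapT => nRy; apply: NC; exists y.
have iL := limit_induced cg i.
have iL' := limit_induced cg i.+1.
have ii' := chain_induced cg (leqnSn i).
have Xg' : X `<=` vert (g i.+1) by move=> x /Xg; exact: ii'.1.
have [g'a g'c] : vert (g i.+1) a /\ vert (g i.+1) c.
  by rewrite vg'; split; right; [left|right].
have [pa pc ac nac] := e.
have pull r x x' : X r -> P (x, x') -> priv (limit h) (f @` X) (f r) x' ->
    priv (limit g) X r x.
  move=> Xr Px [_ nXx' Nx']; split; first by have [] := PL _ _ Px.
    move=> Xx; apply: nXx'; exists x => //.
    exact: ((Piso _ _ _ _ (Pf _ Xx) Px).1.1 erefl).
  move=> v Xv; rewrite (Piso _ _ _ _ Px (Pf _ Xv)).2 Nx'; last by exists v.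
  exact: iff_sym (Piso _ _ _ _ (Pf _ Xv) (Pf _ Xr)).1.
have as_ : parent g a s by exists i; split=> //; apply/Na => //; exact: ba.2.
(* A matched child of [s] born after [a] would force [a] to be matched, by closure under older
   siblings. *)
have young x : dom P x -> adj (limit g) x s -> vert (g i) x \/ x = c.
  move=> Px xs; have [gx|ngx] := pselect (vert (g i) x); [by left|right].
  have [Hx|[j bx]] := bornP cg (adj_vert xs).
    by case: ngx; apply: (chain_mono cg (leq0n i)); exact: (chain_base cg x).2.
  have ij : (i <= j)%N.
    by rewrite leqNgt; apply/negP => ji; apply: ngx; exact: (chain_mono cg ji bx.1).
  have xs' : parent g x s.
    by apply: (born_adj_parent cg bx) => //; exact: (chain_mono cg (leqW ij) (Xg _ Xs)).
  have ji : j = i.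
    apply/eqP; rewrite eq_sym eqn_leq ij /= leqNgt; apply/negP => ltij.
    by apply: nPa; apply: (Pd _ _ Px xs').2 => //; exists i, j.
  have := bx.1; rewrite ji vg' => -[//|[xa|//]].
  by case: nPa; rewrite -xa.
have mem_s x' : priv (limit h) (f @` X) s' x' ->
    exists x, [/\ P (x, x'), priv (limit g) X s x & vert (g i) x \/ x = c].
  move=> px'; have x's : adj (limit h) x' s'.
    by case: px' => _ _ Nx'; apply/Nx' => //; rewrite s'f; exists s.
  have [x Px] := cand _ x's; exists x.
  have px : priv (limit g) X s x by apply: pull Px _ => //; rewrite -s'f.
  split=> //; apply: young; first by exists x'.
  by case: px => _ _ Nx; apply/Nx.
have [a1 [Pa1 pa1 a1ic]] := mem_s _ pa'.
have down r x : X r -> vert (g i) x -> priv (limit g) X r x -> priv (g i) X r x.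
  by move=> Xr gx; exact: (priv_induced _ iL Xg gx).2.
have st_case : s = t -> exists c1, [/\ P (c1, c'), priv (limit g) X s c1
    & vert (g i) c1 \/ c1 = c].
  by move=> st; apply: mem_s; rewrite s'f st -t'f.
have cst : adj (limit g) c s -> s = t.
  move=> cs; have [_ _ Nc1] := pc.
  by apply/(Nc1 s Xs); apply/(iL'.2 _ _ g'c (Xg' _ Xs)).
have distinct x : P (x, a') -> P (x, c') -> False.
  by move=> Px /(Piso _ _ _ _ Px)[[+ _] _] => /(_ erefl)/ac'.
(* If [c] is old, an extension in [g i] is formed by the two pullbacks when the roots coincide, and
   otherwise by [a1] and [c], which are nonadjacent by [F]. *)
have [gc|ngc] := pselect (vert (g i) c).
  have gic x : vert (g i) x \/ x = c -> vert (g i) x by case=> // ->.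
  have ga1 := gic _ a1ic.
  have [st|st] := pselect (s = t).
    have [c1 [Pc1 pc1 /gic gc1]] := st_case st.
    apply: (noext a1 c1); split; try exact: down.
    - by rewrite -st; exact: down.
    - by move=> e1; apply: (@distinct a1) => //; rewrite e1.
    - move=> /(iL.2 _ _ ga1 gc1)/(Piso _ _ _ _ Pa1 Pc1).2; exact: nac'.
  have pcg : priv (g i) X t c by exact: (priv_induced _ ii' Xg gc).2.
  have pcL : priv (limit g) X t c by exact: (priv_induced _ iL Xg gc).1.
  apply: (noext a1 c); split=> //; first exact: down.
    move=> a1c; apply: st; apply: cst; rewrite -a1c.
    by case: pa1 => _ _ Na1; apply/Na1.
  by move=> /(iL.2 _ _ ga1 gc); exact: F.
(* If [c] is new, minimality leaves no private vertex of [s] in [g i], so every pullback is [c].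
   Then the roots coincide, and [a'] and [c'] are both matched with [c]. *)
have only_c x : priv (limit g) X s x -> vert (g i) x \/ x = c -> x = c.
  move=> px [gx|//]; have [npx _] := nopriv ba.2 ngc x.
  by case: npx; exact: down.
have a1c := only_c _ pa1 a1ic.
have st : s = t.
  by apply: cst; rewrite -a1c; case: pa1 => _ _ Na1; apply/Na1.
have [c1 [Pc1 pc1 /(only_c _ pc1) c1c]] := st_case st.
apply: (@distinct c); first by rewrite -{1}a1c.
by rewrite -{1}c1c.
Qed.

(** The vertex [w] is matched with a first-born unmatched child of [r'] rather than with [y], which
    keeps the range closed under older siblings. *)
Lemma partial_iso_attach g h P w r y r' i : chain Hh g -> chain Hh h ->
  partial_iso g h P -> vert (g i) `<=` dom P -> born g i w -> ~ dom P w ->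
  parent g w r -> P (r, r') -> ~ ran P y -> adj (limit h) y r' ->
  exists Q, [/\ partial_iso g h Q, P `<=` Q & ~ Q `<=` P].
Proof.
move=> cg ch [PL Piso PH Pd Pr] gP bw nPw wr Prr nPy yr.
have [z [nPz zr young]] : exists z, [/\ ~ ran P z, parent h z r' &
    forall z', ~ ran P z' -> parent h z' r' -> ~ older h z' z].
  have HR x : vert Hh x -> ran P x by move=> Hx; exists x; exact: PH.
  have Rr : ran P r' by exists r.
  have cand z : ~ ran P z -> adj (limit h) z r' -> parent h z r'.
    move=> nPz /(adj_parent ch)[[/HR//]|[//|]].
    by move=> /(Pr _ _ Rr)[].
  have [j [byj _]] := cand _ nPy yr.
  pose B k := exists z, [/\ born h k z, ~ ran P z & adj (limit h) z r'].
  have exB : exists k, `[< B k >] by exists j; apply/asboolP; exists y.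
  case: (ex_minnP exB) => k /asboolP[z [bz nPz zr]] mink.
  exists z; split=> //; first exact: cand.
  move=> z' nPz' z'r [k1 [k2 [bz' bz2]]].
  rewrite -(born_uniq ch bz bz2) ltnNge => /negP; apply.
  by apply: mink; apply/asboolP; exists z'; split=> //; exact: parent_adj.
have HD : vert Hh `<=` dom P by move=> x Hx; exists x; exact: PH.
have HR : vert Hh `<=` ran P by move=> x Hx; exists x; exact: PH.
have wadj x : dom P x -> adj (limit g) w x <-> x = r.
  exact: outside_adj cg HD Pd nPw wr.
have zadj x : ran P x -> adj (limit h) z x <-> x = r'.
  exact: outside_adj ch HR Pr nPz zr.
exists (P `|` [set (w, z)]); split; last 2 first.
- by move=> p; left.
- by move=> QP; apply: nPw; exists z; apply: QP; right.
have new x x' : P (x, x') -> (w = x <-> z = x') /\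
    (adj (limit g) w x <-> adj (limit h) z x').
  move=> Px; split.
    split=> e; first by case: nPw; rewrite e; exists x'.
    by case: nPz; rewrite e; exists x.
  rewrite wadj ?zadj; [|by exists x|by exists x'].
  exact: (Piso _ _ _ _ Px Prr).1.
split.
- move=> x x' [/PL//|[-> ->]]; split; first exact: adj_vert (parent_adj wr).
  exact: adj_vert (parent_adj zr).
- move=> x x' v v' [Px|[-> ->]] [Pv|[-> ->]].
  + exact: Piso.
  + have [e1 e2] := new _ _ Px; split; first by split=> e; symmetry; apply/e1; symmetry.
    by split=> a; apply: adjC; apply/e2; exact: adjC.
  + exact: new.
  + by split=> //; split=> a; case: (adjxx a).
- by move=> x /PH; left.
- have DD x : dom P x -> dom (P `|` [set (w, z)]) x.
    by move=> [x' Px]; exists x'; left.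
  move=> x p [x' [Px|[-> _]]] xp.
    have [Pp sib] := Pd x p (ex_intro _ x' Px) xp.
    by split=> [|v vp ov]; apply: DD => //; exact: sib.
  rewrite -(parent_uniq cg wr xp); split; first by apply: DD; exists r'.
  (* An older sibling of [w] lies in [g i], all of which is matched. *)
  move=> v _ [k [k' [bv bw']]]; rewrite -(born_uniq cg bw bw') => ki.
  by apply/DD/gP; exact: (chain_mono cg ki bv.1).
- have RR x : ran P x -> ran (P `|` [set (w, z)]) x.
    by move=> [x' Px]; exists x'; left.
  move=> x p [x' [Px|[_ ->]]] xp.
    have [Pp sib] := Pr x p (ex_intro _ x' Px) xp.
    by split=> [|v vp ov]; apply: RR => //; exact: sib.
  rewrite -(parent_uniq ch zr xp); split; first by apply: RR; exists r.
  move=> v vp ov; apply: RR; apply: contrapT => nPv.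
  exact: (young v nPv).
Qed.

(** Choosing [w] first-born among the unmatched vertices puts all of [g i] in the domain, so the
    copy that caused the birth of [w] can be transported to [limit h]. *)
Lemma partial_iso_extend g h P x : chain Hh g -> chain Hh h ->
  clos_refl_trans U (adj Hh) (root_s Hh) (root_t Hh) ->
  ~ (exists H, simplicial_copy Hh (limit h) H) ->
  partial_iso g h P -> vert (limit g) x -> ~ dom P x ->
  exists Q, [/\ partial_iso g h Q, P `<=` Q & ~ Q `<=` P].
Proof.
move=> cg ch walk proper gP Lx nPx.
have [PL Piso PH Pd Pr] := gP.
pose B k := exists z, born g k z /\ ~ dom P z.
have bornD z : vert (limit g) z -> ~ dom P z -> exists k, born g k z.
  by move=> Lz nPz; case: (bornP cg Lz) => // Hz; case: nPz; exists z; exact: PH.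
have exB : exists k, `[< B k >].
  by have [k bx] := bornD _ Lx nPx; exists k; apply/asboolP; exists x.
case: (ex_minnP exB) => i /asboolP[w [bw nPw]] mini.
have gD : vert (g i) `<=` dom P.
  move=> v gv; apply: contrapT => nPv.
  have [|k bv] := bornD v _ nPv; first exact: (limit_induced cg i).1.
  have := born_after cg bv gv; rewrite ltnNge => /negP; apply.
  by apply: mini; apply/asboolP; exists v.
have [e|[H [cH [noext ii' [a [c pe]]]]]] := cg.2 i.
  by case: bw; rewrite e.
have /choice[f fP] : forall v, exists y, dom P v -> P (v, y).
  move=> v; have [[y Pvy]|nPv] := pselect (dom P v); first by exists y.
  by exists v => /nPv.
have HG : induced_subgraph H (g i) by case: cH.
have Pf v : vert H v -> P (v, f v) by move=> /HG.1/gD/fP.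
have cHL : is_copy Hh (limit g) H.
  case: cH => _ iso; split=> //; exact: induced_trans HG (limit_induced cg i).
have [|v v' Hv Hv' e|v v' Hv Hv'|H' [cH' vH' sH' tH']] :=
    @copy_image (limit g) (limit h) H f cHL.
- by move=> v /Pf/PL[].
- exact: (Piso _ _ _ _ (Pf _ Hv) (Pf _ Hv')).1.2 e.
- exact: (Piso _ _ _ _ (Pf _ Hv) (Pf _ Hv')).2.
have [a' [c' e']] : exists a' c',
    ext_pair (limit h) (f @` vert H) (f (root_s H)) (f (root_t H)) a' c'.
  rewrite -vH' -sH' -tH'; apply/has_extP; first by case: cH'.
  by apply: contrapT => next; apply: proper; exists H'.
have F : root_s H <> root_t H -> forall y z,
    priv (limit g) (vert H) (root_s H) y -> priv (limit g) (vert H) (root_t H) z ->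
    ~ adj (limit g) y z.
  by move=> st y z; exact: (connected_priv_nonadj cg walk cHL st).
have [Hs Ht] := (root_s_vert H, root_t_vert H).
have attach r y : vert H r -> parent g w r -> ~ ran P y ->
    adj (limit h) y (f r) -> exists Q, [/\ partial_iso g h Q, P `<=` Q & ~ Q `<=` P].
  move=> Hr wr nPy yr.
  exact: (partial_iso_attach cg ch gP gD bw nPw wr (Pf _ Hr) nPy yr).
have [[e vg'] _ Na Nc _] := pe.
have := bw.1; rewrite vg' => -[/bw.2//|[wa|wc]].
  rewrite wa in bw nPw attach.
  have [y [nPy ys]] := copy_candidate cg ch gP gD HG.1 Hs Ht noext pe bw nPw F Pf
    erefl erefl e'.
  apply: (attach (root_s H) y) => //; exists i; split=> //.
  by apply/Na => //; exact: bw.2.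
(* Here [w] was attached at the second root, so the roots are exchanged. *)
rewrite wc in bw nPw attach.
have [noext' _ _] := pe_step_swap (And3 noext ii' (ex_intro _ a (ex_intro _ c pe))).
have [|y [nPy yt]] := copy_candidate cg ch gP gD HG.1 Ht Hs noext'
    (pe_pair_swap pe) bw nPw _ Pf erefl erefl (ext_pair_swap e').
- by move=> ts y z pz py yz; apply: (F _ z y py pz); [exact/nesym|exact: adjC].
apply: (attach (root_t H) y) => //; exists i; split=> //.
by apply/Nc => //; exact: bw.2.
Qed.

Lemma partial_iso_bigcup g h (F : set (set (U * U))) : F !=set0 ->
  F `<=` partial_iso g h -> total_on F subset ->
  partial_iso g h (\bigcup_(P in F) P).
Proof.
move=> [P0 FP0] Fiso Ftot; split.
- by move=> x y [P /Fiso[PL _ _ _ _] /PL].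
- move=> x y x' y' [P FP Px] [Q FQ Qx'].
  have [PQ|QP] := Ftot _ _ FP FQ.
    by have [_ Qiso _ _ _] := Fiso _ FQ; apply: Qiso => //; exact: PQ.
  by have [_ Piso _ _ _] := Fiso _ FP; apply: Piso => //; exact: QP.
- by move=> x Hx; exists P0 => //; have [_ _ PH _ _] := Fiso _ FP0; exact: PH.
- move=> x p [y [P FP Px]] xp; have [_ _ _ Pd _] := Fiso _ FP.
  have [[q Pp] sib] := Pd x p (ex_intro _ y Px) xp.
  split; first by exists q, P.
  by move=> z zp oz; have [q' Pz] := sib z zp oz; exists q', P.
- move=> x p [y [P FP Px]] xp; have [_ _ _ _ Pr] := Fiso _ FP.
  have [[q Pp] sib] := Pr x p (ex_intro _ y Px) xp.
  split; first by exists q, P.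
  by move=> z zp oz; have [q' Pz] := sib z zp oz; exists q', P.
Qed.

Lemma partial_iso_base g h : chain Hh g -> chain Hh h ->
  partial_iso g h [set p | vert Hh p.1 /\ p.1 = p.2].
Proof.
move=> cg ch.
have iso k : chain Hh k -> induced_subgraph Hh (limit k).
  by move=> ck; rewrite -ck.1; exact: (limit_induced ck 0%N).
split=> //.
- by move=> x y /= [Hx <-]; split; [apply: (iso _ cg).1|apply: (iso _ ch).1].
- move=> x y x' y' /= [Hx <-] [Hx' <-]; split=> //.
  apply: iff_trans (iff_sym ((iso _ cg).2 _ _ Hx Hx')) _.
  exact: (iso _ ch).2.
- by move=> x p [y /= [Hx _]] /(parent_base cg).
- by move=> y p [x /= [Hx <-]] /(parent_base ch).
Qed.

Theorem proper_limits_isomorphic g h : chain Hh g -> chain Hh h ->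
  clos_refl_trans U (adj Hh) (root_s Hh) (root_t Hh) ->
  ~ (exists H, simplicial_copy Hh (limit g) H) ->
  ~ (exists H, simplicial_copy Hh (limit h) H) ->
  isomorphic (limit g) (limit h).
Proof.
move=> cg ch walk properg properh.
pose I0 : set (U * U) := [set p | vert Hh p.1 /\ p.1 = p.2].
have I0iso : partial_iso g h I0 by exact: partial_iso_base.
(* Uniting with [I0] makes the union of the empty family admissible in Zorn's lemma. *)
have [F Fiso Ftot|A [Aiso maxA]] :=
    @Zorn_bigcup (U * U)%type [set A | partial_iso g h (A `|` I0)].
  pose D := [set A `|` I0 | A in F] `|` [set I0].
  rewrite /= (_ : _ `|` _ = \bigcup_(P in D) P).
    apply: partial_iso_bigcup; first by exists I0; right.
      by move=> _ [[A FA <-]|->//]; exact: Fiso.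
    move=> _ _ [[A FA <-]|->] [[B FB <-]|->].
    - by have [AB|BA] := Ftot _ _ FA FB; [left|right]; exact: setSU.
    - by right=> p; right.
    - by left=> p; right.
    - by left.
  apply/seteqP; split=> p.
    move=> [[A FA Ap]|I0p]; last by exists I0; [right|].
    by exists (A `|` I0); left=> //; exists A.
  by move=> [_ [[A FA <-]|->]]; [move=> [Ap|I0p]; [left; exists A|right]|right].
pose P := A `|` I0.
have maxP Q : partial_iso g h Q -> P `<=` Q -> Q `<=` P.
  move=> Qiso PQ; apply: contrapT => nQP; apply: (maxA Q).
    split; last by move=> QA; apply: nQP => p /QA; left.
    by move=> p Ap; apply: PQ; left.
  rewrite /= setUidl // => p I0p; apply: PQ; by right.
have totd x : vert (limit g) x -> dom P x.
  move=> Lx; apply: contrapT => nPx.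
  have [Q [Qiso PQ nQP]] := partial_iso_extend cg ch walk properh Aiso Lx nPx.
  exact/nQP/maxP.
(* The flipped relation is extended, and the result is flipped back. *)
have totr y : vert (limit h) y -> ran P y.
  move=> Ly; apply: contrapT => nPy.
  have [Q [Qiso PQ nQP]] := partial_iso_extend ch cg walk properg
    (partial_iso_flip Aiso) Ly nPy.
  apply: nQP => -[u v] Quv; apply: (maxP _ (partial_iso_flip Qiso)) => //.
  by move=> -[u' v'] Pp; exact: PQ.
have [PL Piso _ _ _] := Aiso.
have /choice[f fP] : forall v, exists y, dom P v -> P (v, y).
  move=> v; have [[y Pvy]|nPv] := pselect (dom P v); first by exists y.
  by exists v => /nPv.
have {}fP v : vert (limit g) v -> P (v, f v) by move=> /totd/fP.
exists f; split; first split.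
- by move=> v /fP/PL[].
- move=> v v'; rewrite !inE => /fP Pv /fP Pv'.
  exact: (Piso _ _ _ _ Pv Pv').1.2.
- move=> y Ly; have [x Px] := totr y Ly; have Lx := (PL _ _ Px).1.
  by exists x => //; exact: (Piso _ _ _ _ (fP _ Lx) Px).1.1.
move=> v v' /fP Pv /fP Pv'; exact: (Piso _ _ _ _ Pv Pv').2.
Qed.

End Uniqueness.

(** * Local finiteness of limits *)

Section LocalFiniteness.
Variables (U : Type) (Hh : two_rooted U) (g : nat -> graph U).
Hypothesis cg : chain Hh g.

(* Distinct children of [s] that are not private for [X] are charged to distinct
   vertices of [X] in their branches, and the at most one private child to [s]. *)
Lemma children_card_le i X s t a c : X `<=` vert (g i) -> X s ->
  X t -> no_ext (g i) X s t -> pe_pair (g i) X s t (g i.+1) a c ->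
  ~ vert (g i) a -> [set x | vert (g i) x /\ parent g x s] #<= X.
Proof.
move=> Xg Xs Xt noext [[[pa pc ac nac] vg'] _ Na Nc nopriv] nga.
have iL := limit_induced cg i.
have ii' := chain_induced cg (leqnSn i).
have child_adj x : vert (g i) x -> parent g x s -> adj (g i) x s.
  by move=> gx xs; apply/(iL.2 _ _ gx (Xg _ Xs)); exact: parent_adj.
(* A private child of [s] forces [c] to be old. If the roots coincide, two such children form an
   extension, siblings being nonadjacent; otherwise each of them is the parent of [c]. *)
have priv_uniq x x' : parent g x s -> parent g x' s ->
    priv (g i) X s x -> priv (g i) X s x' -> x = x'.
  move=> xs xs' px px'; have [gx _ _] := px; have [gx' _ _] := px'.
  have [gc|ngc] := pselect (vert (g i) c); last by case: (nopriv nga ngc x).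
  have pcg : priv (g i) X t c by exact: (priv_induced _ ii' Xg gc).2.
  apply: contrapT => xx'.
  have [st|st] := pselect (s = t).
    apply: (noext x x'); split=> //; first by rewrite -st.
    move=> /(iL.2 _ _ gx gx')/(adj_parent cg)[[Hx _]|[xx|x'x]].
    - exact: parent_base xs Hx.
    - apply: (parent_asym cg xs); have e := parent_uniq cg xs xx.
      by rewrite -e in xs'; case: (parent_asym cg xs' xs').
    - have e := parent_uniq cg xs' x'x.
      by rewrite -e in xs; case: (parent_asym cg xs xs).
  have to_c z : parent g z s -> priv (g i) X s z -> parent g c z.
    move=> zs pz; have [gz _ Nz] := pz; have [_ nXc Ncg] := pcg.
    have zc : z <> c.
      by move=> e; apply: st; apply/Ncg => //; rewrite -e; exact: child_adj.
    have : adj (limit g) z c.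
      apply/(iL.2 _ _ gz gc); apply: contrapT => nzc.
      exact: (noext z c).
    case/(adj_parent cg) => [[Hz _]|[zc'|//]]; first by case: (parent_base cg zs).
    by case: nXc; rewrite -(parent_uniq cg zs zc').
  exact: xx' (parent_uniq cg (to_c _ xs px) (to_c _ xs' px')).
have /choice[f fP] : forall x, exists y, vert (g i) x -> parent g x s -> X y /\
    (priv (g i) X s x /\ y = s \/ ~ priv (g i) X s x /\ (y = x \/ parent g y x)).
  move=> x; have [px|npx] := pselect (priv (g i) X s x).
    by exists s; split=> //; left.
  have [Xx|nXx] := pselect (X x).
    by exists x; split=> //; right; split=> //; left.
  have [[gx xs]|no] := pselect (vert (g i) x /\ parent g x s); last first.
    by exists s => gx xs; case: no.
  have [v [Xv vs xv]] : exists v, [/\ X v, v <> s & adj (g i) x v].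
    apply: contrapT => nov; apply: npx; split=> // v Xv; split=> [xv|->].
      by apply: contrapT => vs; apply: nov; exists v.
    exact: child_adj.
  exists v => _ _; split=> //; right; split=> //; right.
  have := (iL.2 _ _ gx (Xg _ Xv)).1 xv.
  case/(adj_parent cg) => [[Hx _]|[xv'|//]]; first by case: (parent_base cg xs).
  by case: vs; rewrite -(parent_uniq cg xs xv').
have ss : ~ parent g s s by move=> p; exact: (parent_asym cg p p).
apply: (@injection_card_le _ _ _ _ f) => [x [gx xs]|x x' [gx xs] [gx' xs']].
  by have [] := fP x gx xs.
have [_ hx] := fP x gx xs; have [_ hx'] := fP x' gx' xs'.
case: hx hx' => [[px ->]|[npx hx]] [[px' ->]|[npx' hx']].
- by move=> _; exact: priv_uniq.
- move=> e; rewrite -e in hx'; case: hx' => [sx'|sx'].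
    by case: ss; rewrite {1}sx'.
  by case: (parent_asym cg xs' sx').
- move=> e; rewrite e in hx; case: hx => [sx|sx].
    by case: ss; rewrite {1}sx.
  by case: (parent_asym cg xs sx).
move=> e; rewrite -e in hx'; case: hx hx' => [->|fx] [fx'|fx'] //.
- by case: ss; rewrite {1}(parent_uniq cg xs fx').
- by rewrite fx' in fx; case: ss; rewrite {1}(parent_uniq cg xs' fx).
- exact: (parent_uniq cg fx fx').
Qed.

(** With infinitely many children of [v], some stage has more of them than the base has vertices. A
    later step attaching one more child contradicts [children_card_le], since a copy has no more
    vertices than the base. *)
Lemma limit_locally_finite v : finite_set [set x | adj (limit g) v x].
Proof.
pose Ch := [set x | parent g x v].
suff finC : finite_set Ch.
  have finp : finite_set [set p | parent g v p].
    have [[p vp]|nop] := pselect (exists p, parent g v p).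
      apply: sub_finite_set (finite_set1 p) => q vq.
      exact: (parent_uniq cg vq vp).
    apply: sub_finite_set (@finite_set0 U) => q vq.
    by apply: nop; exists q.
  apply: (@sub_finite_set _ _ (vert Hh `|` ([set p | parent g v p] `|` Ch))).
    move=> x /(adj_parent cg)[[_ Hx]|[vx|xv]]; first by left.
      by right; left.
    by right; right.
  by rewrite !finite_setU; split=> //; exact: tr_finite.
apply: contrapT => infC.
have [n Hn] := tr_finite Hh.
have [f [fC fI]] := card_le_injection v ((infiniteP _).1 infC).
have ChL x : Ch x -> vert (limit g) x by move=> xv; exact: adj_vert (parent_adj xv).
have [i0 F0] : exists i, f @` `I_n.+1 `<=` vert (g i).
  apply: (limit_finite cg); first exact: finite_image.
  by move=> _ [k _ <-]; apply/ChL/fC.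
have [w [wv nw]] := infinite_setN0 (infinite_setD infC (chain_finite cg i0)).
have [i [bw gwv]] := wv.
have i0i : (i0 <= i)%N.
  by rewrite leqNgt; apply/negP => /(chain_mono cg)/(_ bw.1).
have [e|[H [[HG [k [[[_ _ kS] _] _ _]]] [noext ii' [a [c pe]]]]]] := cg.2 i.
  by case: bw; rewrite e.
suff : `I_n.+1 #<= vert H.
  move=> le; have := card_le_trans (subset_card_le kS) (card_image_le _ _).
  move=> /(card_le_trans le).
  by rewrite (card_le_eqr Hn) card_le_II ltnn.
have [Hs Ht] := (root_s_vert H, root_t_vert H).
suff : [set x | vert (g i) x /\ parent g x v] #<= vert H.
  apply: card_le_trans; apply: (@injection_card_le _ _ _ _ f) => [j Ij|j j' _ _].
    by split; [apply: (chain_mono cg i0i); apply: F0; exists j|exact: fC].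
  exact: fI.
have [[_ vg'] _ Na Nc _] := pe.
have := bw.1; rewrite vg' => -[/bw.2//|[wa|wc]].
  rewrite wa in bw gwv; have -> := (Na bw.2 v).1 gwv.
  exact: children_card_le HG.1 Hs Ht noext pe bw.2.
rewrite wc in bw gwv; have -> := (Nc bw.2 v).1 gwv.
have [noext' _ _] := pe_step_swap (And3 noext ii' (ex_intro _ a (ex_intro _ c pe))).
exact: children_card_le HG.1 Ht Hs noext' (pe_pair_swap pe) bw.2.
Qed.

(* Step [i] attaches a vertex at distance 0 or 3 from [v]; distance 3 is that of
   the second root when the private neighbours of the roots are joined. *)
Definition used i v := exists w u, [/\ born g i w, parent g w u & v = u \/
  exists p q, [/\ adj (limit g) v q, adj (limit g) q p & adj (limit g) p u]].

(** By local finiteness, the vertices at which a step near [v] can attach have finitely many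
    neighbours in total. Once these are all present, no such step remains. *)
Lemma eventually_unused v : exists i0, forall i, (i0 <= i)%N -> ~ used i v.
Proof.
pose N x := [set y | adj (limit g) x y].
pose B := v |` \bigcup_(q in N v) \bigcup_(p in N q) N p.
have finB : finite_set B.
  rewrite finite_setU; split; first exact: finite_set1.
  apply: bigcup_finite => [|q _]; first exact: limit_locally_finite.
  apply: bigcup_finite => [|p _]; exact: limit_locally_finite.
have [i0 M0] : exists i, \bigcup_(u in B) N u `<=` vert (g i).
  apply: (limit_finite cg).
    by apply: bigcup_finite => // u _; exact: limit_locally_finite.
  by move=> x [u _ ux]; exact: adj_vert2 ux.
exists i0 => i i0i [w [u [bw wu vu]]].
apply: bw.2; apply: (chain_mono cg i0i); apply: M0; exists u.
  case: vu => [<-|[p [q [vq qp pu]]]]; first by left.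
  by right; exists q => //; exists p.
by apply: adjC; exact: parent_adj.
Qed.

End LocalFiniteness.

(** * Replaying a step of the sequence in a larger graph *)

Section Merge.
Variables (U : Type) (Hh : two_rooted U) (g : nat -> graph U).
Hypothesis cg : chain Hh g.

Definition union_graph (G G' : graph U) : graph U :=
  graph_of (vert G `|` vert G') (fun x y => adj G x y \/ adj G' x y).

(** Here [G] is stage [i] of [g] with extra vertices. These avoid the later stages too and meet
    stage [i] only at vertices near which [g] no longer acts, so the remaining steps of [g] can be
    replayed in [G]. *)
Definition harmless i (G : graph U) := [/\ induced_subgraph (g i) G,
  forall x, vert G x -> vert (limit g) x -> vert (g i) x &
  forall x v, vert G x -> ~ vert (g i) x -> adj G x v -> vert (g i) v ->
    forall j, (i <= j)%N -> ~ used g j v].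

(** The two graphs overlap in [g i], which is induced in both, so gluing creates no edge inside
    either. *)
Lemma harmless_union i G : harmless i G ->
  induced_subgraph G (union_graph G (g i.+1)) /\
  induced_subgraph (g i.+1) (union_graph G (g i.+1)).
Proof.
move=> [iG GL _]; have ii' := chain_induced cg (leqnSn i).
have Gg x : vert G x -> vert (g i.+1) x -> vert (g i) x.
  by move=> Gx gx; apply: GL => //; exact: (limit_induced cg i.+1).1.
split.
  split=> [x|x y Gx Gy]; first by left.
  have down u v : vert G u -> vert G v -> adj (g i.+1) u v -> adj G u v.
    move=> Gu Gv uv; have gu := Gg _ Gu (adj_vert uv).
    have gv := Gg _ Gv (adj_vert2 uv).
    by apply/(iG.2 _ _ gu gv)/(ii'.2 _ _ gu gv).
  split=> [xy|[_ _ _ []]].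
  - by split; [left|left|exact: adj_neq xy|left; left].
  - by case=> // xy; exact: down.
  - by case=> yx; apply: adjC => //; exact: down.
split=> [x|x y gx gy]; first by right.
have up u v : vert (g i.+1) u -> vert (g i.+1) v -> adj G u v -> adj (g i.+1) u v.
  move=> gu gv uv; have gu' := Gg _ (adj_vert uv) gu.
  have gv' := Gg _ (adj_vert2 uv) gv.
  by apply/(ii'.2 _ _ gu' gv')/(iG.2 _ _ gu' gv').
split=> [xy|[_ _ _ []]].
- by split; [right|right|exact: adj_neq xy|left; right].
- by case=> // xy; exact: up.
- by case=> yx; apply: adjC => //; exact: up.
Qed.

(** An extra vertex is never adjacent to a used root. *)
Lemma priv_harmless i G X r x : harmless i G -> X `<=` vert (g i) -> X r ->
  used g i r -> priv G X r x -> vert (g i) x.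
Proof.
move=> [_ _ far] Xg Xr ur [Gx _ Nx]; apply: contrapT => ngx.
apply: (far x r Gx ngx _ (Xg _ Xr) i (leqnn i) ur).
exact/Nx.
Qed.

(** The root [s] is used because [a] is attached there. Once [t] is known to be used as well, an
    extension in [G] already lies in [g i]. *)
Lemma merge_no_ext i G X s t a c : harmless i G -> X `<=` vert (g i) ->
  X s -> X t -> no_ext (g i) X s t -> pe_pair (g i) X s t (g i.+1) a c ->
  ~ vert (g i) a -> no_ext G X s t.
Proof.
move=> hG Xg Xs Xt noext [[[pa pc ac nac] vg'] _ Na Nc nopriv] nga a' c' e.
have [iG _ _] := hG.
have iL := limit_induced cg i.
have ii' := chain_induced cg (leqnSn i).
have g'a : vert (g i.+1) a by rewrite vg'; right; left.
have as_ : parent g a s by exists i; split=> //; exact/Na.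
have us : used g i s by exists a, s; split=> //; left.
have [pa' pc' ac' nac'] := e.
have ga' := priv_harmless hG Xg Xs us pa'.
have pa'g : priv (g i) X s a' by exact: (priv_induced _ iG Xg ga').2.
have [gc|ngc] := pselect (vert (g i) c); last by case: (nopriv nga ngc a').
have pcg : priv (g i) X t c by exact: (priv_induced _ ii' Xg gc).2.
suff ut : used g i t.
  have gc' := priv_harmless hG Xg Xt ut pc'.
  by apply: (noext a' c'); exact: (ext_pair_induced _ _ iG Xg ga' gc').2.
(* For distinct roots, [a'] and [c] are adjacent because [g i] has no extension. The path from [t]
   through [c] and [a'] to [s] accounts for the distance 3 in [used]. *)
have [<-//|st] := pselect (s = t).
have [_ _ Na'] := pa'g; have [_ _ Ncg] := pcg.
have a's : adj (g i) a' s by exact/Na'.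
have ct : adj (g i) c t by exact/Ncg.
exists a, s; split=> //; right; exists a', c; split.
- by apply/(iL.2 _ _ (Xg _ Xt) gc); exact: adjC.
- apply/(iL.2 _ _ gc ga'); apply: adjC; apply: contrapT => na'c.
  apply: (noext a' c); split=> // a'c.
  by apply: st; apply/Ncg => //; rewrite -a'c.
- exact/(iL.2 _ _ ga' (Xg _ Xs)).
Qed.

(** The same [a] and [c] serve in the larger graph: extra vertices create no extension and, when
    both [a] and [c] are new, no private vertex. *)
Lemma merge_step i G X s t : harmless i G -> X `<=` vert (g i) ->
  X s -> X t -> pe_step (g i) X s t (g i.+1) ->
  pe_step G X s t (union_graph G (g i.+1)).
Proof.
move=> hG Xg Xs Xt st; have [noext ii' [a [c pe]]] := st.
have [noext' _ _] := pe_step_swap st.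
have [[e vg'] nac Na Nc nopriv] := pe.
have [iG GL _] := hG.
have GX : X `<=` vert G by move=> x /Xg; exact: iG.1.
have Gg x : vert G x -> vert (g i.+1) x -> vert (g i) x.
  by move=> Gx gx; apply: GL => //; exact: (limit_induced cg i.+1).1.
have [iGu igu] := harmless_union hG.
have Xg' : X `<=` vert (g i.+1) by move=> x /Xg; exact: ii'.1.
have [g'a g'c] : vert (g i.+1) a /\ vert (g i.+1) c.
  by rewrite vg'; split; right; [left|right].
have new x r : vert (g i.+1) x -> ~ vert G x ->
    (forall v, adj (g i.+1) x v <-> v = r) ->
    forall v, adj (union_graph G (g i.+1)) x v <-> v = r.
  move=> gx nGx Nx v; split=> [[_ _ _ []]|->].
  - by case=> [xv|/Nx//]; case: nGx; exact: adj_vert xv.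
  - case=> [vx|vx]; first by case: nGx; exact: adj_vert2 vx.
    by apply/Nx; exact: adjC.
  by apply/igu.2 => //; [apply: (adj_vert2 (x := x)); exact/Nx | exact/Nx].
split=> //.
  have [ga|nga] := pselect (vert (g i) a); last exact: merge_no_ext pe nga.
  have ngc : ~ vert (g i) c by move=> gc; exact: nac.
  move=> a' c' e'.
  apply: (merge_no_ext hG Xg Xt Xs noext' (pe_pair_swap pe) ngc).
  exact: ext_pair_swap e'.
exists a, c; split=> //.
- split; first exact/(ext_pair_induced _ _ igu).
  apply/seteqP; split=> x /=; first by rewrite vg' => -[|[/iG.1|]]; [left|left|right].
  by case=> [|ac]; [left|right; rewrite vg'; right].
- by move=> [Ga Gc]; apply: nac; split; exact: Gg.
- by move=> nGa; apply: new => //; apply: Na => /iG.1.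
- by move=> nGc; apply: new => //; apply: Nc => /iG.1.
move=> nGa nGc x.
have nga : ~ vert (g i) a by move=> /iG.1.
have ngc : ~ vert (g i) c by move=> /iG.1.
have us : used g i s.
  by exists a, s; split=> //; [exists i; split=> //; exact/Na|left].
have ut : used g i t.
  by exists c, t; split=> //; [exists i; split=> //; exact/Nc|left].
have [ns nt] := nopriv nga ngc x.
split=> px.
  have gx := priv_harmless hG Xg Xs us px.
  by apply: ns; exact: (priv_induced _ iG Xg gx).2.
have gx := priv_harmless hG Xg Xt ut px.
by apply: nt; exact: (priv_induced _ iG Xg gx).2.
Qed.

End Merge.

(** * Completing a sequence to a proper one *)

Section Sequences.
Variables (U : Type) (Hh : two_rooted U).
Implicit Types (S : nat -> option (graph U)) (g : nat -> graph U).

(** After the end of [S] the last graph is repeated, which turns a finite sequence into a chain with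
    idle steps. *)
Fixpoint stabilize S i : graph U :=
  if i is j.+1 then odflt (stabilize S j) (S i) else Hh.

Lemma stabilize_some S i G : PE_sequence Hh S -> S i = Some G -> stabilize S i = G.
Proof. by case: i => [|i] [S0 _] /= Si; [move: Si; rewrite S0 => -[] | rewrite Si]. Qed.

Lemma stabilize_mem S i : PE_sequence Hh S -> exists j, S j = Some (stabilize S i).
Proof.
move=> [S0 _]; elim: i => [|i [j Sj]] /=; first by exists 0%N.
by case E : (S i.+1) => [G|] /=; [exists i.+1|exists j].
Qed.

Lemma stabilize_chain S : PE_sequence Hh S -> chain Hh (stabilize S).
Proof.
move=> PS; split=> // i; have [S0 /(_ i)] := PS.
case E : (S i) => [G|]; last by move=> /= ->; left.
have Gi := stabilize_some PS E.
have [ex|nex] := pselect (exists H, simplicial_copy Hh G H).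
  move=> [/(_ ex)[H [G' [[cH simp] pe SG']] _]]; right; exists H.
  rewrite (stabilize_some PS SG') Gi; split=> //.
  by apply: pendant_extension_step => //; case: cH.
by move=> [_ /(_ nex) SN]; left; rewrite /= SN.
Qed.

Lemma stabilize_limit S : PE_sequence Hh S -> limit (stabilize S) = limit_graph S.
Proof.
move=> PS; apply: graph_ext => [x|x y]; split.
- move=> [i [G [[<-] Gx]]]; have [j Sj] := stabilize_mem i PS.
  by exists j, (stabilize S i).
- by move=> [i [G [SG Gx]]]; exists i, G; rewrite (stabilize_some PS SG).
- move=> [i [G [[<-] Gxy]]]; have [j Sj] := stabilize_mem i PS.
  by exists j, (stabilize S i).
- by move=> [i [G [SG Gxy]]]; exists i, G; rewrite (stabilize_some PS SG).
Qed.

(** A sequence ends only when its last graph has no simplicial copy, and that graph is the limit. *)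
Lemma ended_proper S i : PE_sequence Hh S -> S i = None -> proper_PE_sequence Hh S.
Proof.
move=> PS SN; split=> //; rewrite -(stabilize_limit PS).
have exN : exists k, ~~ isSome (S k) by exists i; rewrite SN.
have [S0 step] := PS.
case: (ex_minnP exN) => -[|j]; first by rewrite S0.
case SjN : (S j.+1) => // _ minj.
have [G SG] : exists G, S j = Some G.
  by case E : (S j) => [G|]; [exists G|have := minj j; rewrite E ltnn => /(_ isT)].
have := step j; rewrite SG => -[stepG _].
have nG : ~ exists H, simplicial_copy Hh G H.
  by move=> /stepG[H [G' [_ _]]]; rewrite SjN.
suff -> : limit (stabilize S) = G by [].
have cS := stabilize_chain PS.
have Gj := stabilize_some PS SG.
have SN' k : S (j.+1 + k)%N = None.
  elim: k => [|k IH]; first by rewrite addn0.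
  by have := step (j.+1 + k)%N; rewrite IH addnS.
have const k : stabilize S (j + k)%N = G.
  elim: k => [|k IH]; first by rewrite addn0.
  by rewrite addnS /= -addSn SN'.
have LG x : vert (limit (stabilize S)) x -> vert G x.
  move=> /limit_vertP[k]; have [kj|/ltnW jk] := leqP k j.
    by rewrite -Gj; exact: (chain_mono cS).
  by rewrite -(subnKC jk) const.
have iG : induced_subgraph G (limit (stabilize S)).
  by rewrite -{1}Gj; exact: (limit_induced cS).
apply: graph_ext => [x|x y]; first by split=> [/LG//|Gx]; exact: iG.1.
split=> xy.
  exact: (iG.2 _ _ (LG _ (adj_vert xy)) (LG _ (adj_vert2 xy))).2.
exact: (iG.2 _ _ (adj_vert xy) (adj_vert2 xy)).1.
Qed.

Lemma strict_chain_PE_sequence g : g 0%N = Hh ->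
  (forall i, exists H, is_copy Hh (g i) H /\
    pe_step (g i) (vert H) (root_s H) (root_t H) (g i.+1)) ->
  PE_sequence Hh (fun i => Some (g i)).
Proof.
move=> g0 step; split=> [|i]; first by rewrite g0.
have [H [cH st]] := step i; have [HG _] := cH.
have simp : simplicial_copy Hh (g i) H.
  split=> // /(has_extP HG)[a [c e]].
  by have [noext _ _] := st; exact: noext e.
split=> [_|]; last by case; exists H.
by exists H, (g i.+1); split=> //; exact: step_pendant_extension.
Qed.

(** The stages are finite, so an infinite [U] always has vertices left for the next pendant
    extension. *)
Lemma PE_sequence_exists : infinite_set [set: U] -> exists S, PE_sequence Hh S.
Proof.
move=> infU.
pose P G G' := exists H, simplicial_copy Hh G H /\ pendant_extension G H G'.
pose next o := if o is Some G then
  if pselect (exists G', P G G') is left e then Some (projT1 (cid e)) else None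
  else None.
pose S i := iter i next (Some (tr_graph Hh)).
have Sfin i G : S i = Some G -> finite_set (vert G).
  elim: i G => [G [<-]|i IH G]; first exact: tr_finite.
  rewrite /S iterS -/(S i); case E : (S i) => [G0|//] /=.
  case: pselect => // e [<-]; have [H [[[HG _] simp] pe]] := projT2 (cid e).
  exact: finite_step (IH _ E) (pendant_extension_step HG simp pe).
exists S; split=> // i.
have SS : S i.+1 = next (S i) by [].
case E : (S i) => [G|]; rewrite SS E /next //.
case: pselect => [e|ne].
  have [H [sH pe]] := projT2 (cid e).
  by split; [exists H, (projT1 (cid e))|case; exists H].
split=> // -[H [cH simp]]; case: ne.
have HG : induced_subgraph H G by case: cH.
have [|||G' [st _]] := @pe_step_exists U G (vert H) setT (root_s H) (root_t H)
    (Sfin _ _ E) infU HG.1.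
- exact: root_s_vert.
- exact: root_t_vert.
- by move=> a c e; apply: simp; apply/(has_extP HG); exists a, c.
by exists G', H; split=> //; exact: step_pendant_extension.
Qed.

(** * Dovetailing repairs with a given infinite sequence *)

Section Completion.
(** Repairs draw their new vertices from the reservoir [N], disjoint from the limit of [g]. A copy
    is coded by its vertex set and roots, which determine it as an induced subgraph. *)
Variables (g : nat -> graph U) (N V : set U)
  (code : set U * U * U -> nat).
Hypotheses (cg : chain Hh g)
  (strict : forall i, exists H, is_copy Hh (g i) H /\
    pe_step (g i) (vert H) (root_s H) (root_t H) (g i.+1))
  (infN : infinite_set N) (NL : forall x, N x -> ~ vert (limit g) x)
  (LV : vert (limit g) `<=` V) (NV : N `<=` V)
  (codeI : forall X Y s t s' t', X `<=` V -> finite_set X -> X s -> X t ->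
    Y `<=` V -> finite_set Y -> Y s' -> Y t' ->
    code (X, s, t) = code (Y, s', t') -> [/\ X = Y, s = s' & t = t']).

(* At even stages the copy designated by the stage number is repaired, once the
   sequence [g] will no longer act near its roots; otherwise [g] advances. *)
Definition due m i G (H : two_rooted U) := [/\ ~~ odd m,
  exists k : nat, choice.unpickle m./2 = Some (code (vert H, root_s H, root_t H), k),
  is_copy Hh G H, no_ext G (vert H) (root_s H) (root_t H)
  & forall j, (i <= j)%N -> ~ used g j (root_s H) /\ ~ used g j (root_t H)].

Definition stage_step m (p q : nat * graph U) :=
  (exists H, [/\ due m p.1 p.2 H, q.1 = p.1 &
    pe_step p.2 (vert H) (root_s H) (root_t H) q.2]) \/
  [/\ ~ (exists H, due m p.1 p.2 H), q.1 = p.1.+1 &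
    q.2 = union_graph p.2 (g p.1.+1)].

Definition stage_inv (p : nat * graph U) :=
  [/\ harmless g p.1 p.2, finite_set (vert p.2) & vert p.2 `<=` V].

(** Both kinds of stage preserve [harmless]: a repair attaches vertices of [N] only to roots that
    are no longer used, and an advance adds only vertices of the limit of [g]. *)
Lemma stage_step_exists m p : stage_inv p ->
  exists q, stage_step m p q /\ stage_inv q.
Proof.
case: p => i G [hG finG GV]; have /= [iG GL far] := hG.
have [[H dH]|nd] := pselect (exists H, due m i G H); last first.
  exists (i.+1, union_graph G (g i.+1)); split; first by right.
  have [H [[HG _] st]] := strict i.
  have [_ iGu _] := merge_step cg hG HG.1 (root_s_vert H) (root_t_vert H) st.
  have g'L := limit_induced cg i.+1.
  have igu : induced_subgraph (g i.+1) (union_graph G (g i.+1)).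
    exact: (harmless_union cg hG).2.
  split=> /=.
  - split=> //= [x [Gx|//] Lx|x v [Gx|//] ngx xv gv j ij].
      exact: (chain_mono cg (leqnSn i)) (GL _ Gx Lx).
    have nx : ~ vert (g i) x.
      by move=> gx; apply: ngx; exact: (chain_mono cg (leqnSn i)).
    have Gxv : adj G x v.
      case: xv => _ _ _ [] [//|xv].
      - by case: ngx; exact: adj_vert xv.
      - exact: adjC.
      - by case: ngx; exact: adj_vert2 xv.
    have gv' : vert (g i) v.
      by apply: GL (adj_vert2 Gxv) _; exact: g'L.1.
    by apply: (far _ _ Gx nx Gxv gv'); exact: ltnW.
  - by rewrite finite_setU; split=> //; exact: chain_finite cg _.
  - by move=> x [/GV//|/g'L.1/LV].
have [_ _ [HG _] noext unus] := dH.
have [G' [st G'N]] := pe_step_exists finG infN HG.1 (root_s_vert H)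
  (root_t_vert H) noext.
have [_ iGG' [a [c [[_ vG'] _ Na Nc _]]]] := st.
exists (i, G'); split; first by left; exists H.
split=> /=; last 2 first.
- exact: finite_step st.
- by move=> x /G'N[/GV|/NV].
split=> [|x /G'N[/GL//|/NL//]|x v G'x ngx xv gv j ij].
  exact: induced_trans iGG'.
have [Gx|nGx] := pselect (vert G x).
  apply: (far x v) => //; apply/iGG'.2 => //.
  exact: iG.1.
have [us ut] := unus _ ij.
move: G'x; rewrite vG' => -[//|[xa|xc]].
  by rewrite xa in nGx xv; rewrite ((Na nGx v).1 xv).
by rewrite xc in nGx xv; rewrite ((Nc nGx v).1 xv).
Qed.

Lemma completion : exists h, [/\ h 0%N = tr_graph Hh,
  forall m, exists H, is_copy Hh (h m) H /\
    pe_step (h m) (vert H) (root_s H) (root_t H) (h m.+1),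
  induced_subgraph (limit g) (limit h)
  & ~ exists H, simplicial_copy Hh (limit h) H].
Proof.
have /choice[next nextP] : forall mp : nat * (nat * graph U), exists q,
    stage_inv mp.2 -> stage_step mp.1 mp.2 q /\ stage_inv q.
  move=> [m p]; have [/(stage_step_exists m)[q qP]|np] := pselect (stage_inv p).
    by exists q.
  by exists p.
pose F := fix F m := if m is k.+1 then next (k, F k) else (0%N, tr_graph Hh).
have inv m : stage_inv (F m).
  elim: m => [|m IH]; last by have [] := nextP (m, F m) IH.
  have HL : induced_subgraph (g 0%N) (limit g) by exact: (limit_induced cg).
  split=> /=; last 2 first.
  - exact: tr_finite.
  - by rewrite -cg.1; move=> x /HL.1/LV.
  by rewrite -cg.1; split; [exact: induced_refl| |].
have step m : stage_step m (F m) (F m.+1) by have [] := nextP (m, F m) (inv m).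
pose h m := (F m).2.
have hstep m : exists H, is_copy Hh (h m) H /\
    pe_step (h m) (vert H) (root_s H) (root_t H) (h m.+1).
  have [[H [[_ _ cH _ _] _ st]]|[_ e1 e2]] := step m; first by exists H.
  have [[ig _ _] _ _] := inv m.
  have [H [[HG iso] st]] := strict (F m).1.
  exists H; split; first by split=> //; exact: induced_trans HG ig.
  rewrite /h e2; have [hG _ _] := inv m.
  exact: (merge_step cg hG HG.1 (root_s_vert H) (root_t_vert H) st).
have ch : chain Hh h by split=> // m; right.
have mono m k : ((F m).1 <= (F (m + k)).1)%N.
  elim: k => [|k IH]; first by rewrite addn0.
  rewrite addnS; apply: leq_trans IH _.
  by have [[H [_ -> _]]|[_ -> _]] := step (m + k)%N.
have monoF m m' : (m <= m')%N -> ((F m).1 <= (F m').1)%N.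
  by move=> /subnKC <-.
have grow k : exists m, (k <= (F m).1)%N.
  elim: k => [|k [m km]]; first by exists 0%N.
  (* Stage [m.*2.+1] is odd, so no repair is due and [g] advances. *)
  exists m.*2.+2; apply: (@leq_ltn_trans (F m.*2.+1).1).
    by apply: leq_trans km _; apply: monoF; rewrite -addnn; lia.
  have [[H [[+ _ _ _ _] _ _]]|[_ e _]] := step m.*2.+1.
    by rewrite /= odd_double.
  by rewrite e.
have ghL x : vert (limit g) x -> exists m, vert (g (F m).1) x.
  move=> /limit_vertP[k gx]; have [m km] := grow k.
  by exists m; exact: (chain_mono cg km).
have gh m : induced_subgraph (g (F m).1) (h m) by have [[]] := inv m.
exists h; split=> //.
  split=> [x /ghL[m gx]|x y /ghL[m1 gx] /ghL[m2 gy]].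
    by apply/limit_vertP; exists m; exact: (gh m).1.
  pose m := maxn m1 m2.
  have gx' := chain_mono cg (monoF _ _ (leq_maxl m1 m2)) gx.
  have gy' := chain_mono cg (monoF _ _ (leq_maxr m1 m2)) gy.
  apply: iff_trans (iff_sym ((limit_induced cg _).2 _ _ gx' gy')) _.
  apply: iff_trans ((gh m).2 _ _ gx' gy') _.
  by apply: (limit_induced ch m).2; exact: (gh m).1.
move=> [H [[HL iso] simp]].
have [m0 Hm0] := limit_finite ch (tr_finite H) HL.1.
have [is_ us] := eventually_unused cg (root_s H).
have [it_ ut] := eventually_unused cg (root_t H).
have [m1 m1P] := grow (maxn is_ it_).
pose n := code (vert H, root_s H, root_t H).
have pickleI : injective (fun k : nat => choice.pickle (n, k)).
  by move=> k k' /(pcan_inj choice.pickleK)[].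
(* The second component [k] makes the designation of the copy recur at arbitrarily late stages. *)
have [k kP] := injective_gtn pickleI (maxn m0 m1).
pose m := (choice.pickle (n, k)).*2.
have m0m : (m0 <= m)%N by rewrite /m -addnn; lia.
have m1m : (m1 <= m)%N by rewrite /m -addnn; lia.
have Hm : vert H `<=` vert (h m) by move=> x /Hm0; exact: (chain_mono ch m0m).
have hmL := limit_induced ch m.
have HGm : induced_subgraph H (h m).
  split=> // x y Hx Hy; rewrite HL.2//.
  exact: iff_sym (hmL.2 _ _ (Hm _ Hx) (Hm _ Hy)).
have noextL : no_ext (limit h) (vert H) (root_s H) (root_t H).
  by move=> a c e; apply: simp; apply/(has_extP HL); exists a, c.
have dH : due m (F m).1 (F m).2 H.
  split.
  - by rewrite /m odd_double.
  - by exists k; rewrite /m doubleK choice.pickleK.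
  - by split.
  - move=> a c e; apply: (noextL a c); apply/(ext_pair_induced _ _ hmL) => //.
      by case: e => -[].
    by case: e => _ [].
  move=> j ij; have := leq_trans m1P (leq_trans (monoF _ _ m1m) ij).
  by rewrite geq_max => /andP[]; split; [exact: us|exact: ut].
have [[H' [dH' _ st]]|[nd _ _]] := step m; last by apply: nd; exists H.
have [_ _ hV] := inv m.
have [_ [k' kk'] [HG' _] _ _] := dH'.
move: kk'; rewrite /m doubleK choice.pickleK => -[nn' _].
(* The stage may repair another record [H'], but equal codes give the same vertex set and roots, on
   which alone [pe_step] depends. *)
have [eX es et] := codeI (subset_trans Hm hV) (tr_finite H) (root_s_vert H)
  (root_t_vert H) (subset_trans HG'.1 hV) (tr_finite H') (root_s_vert H')
  (root_t_vert H') nn'.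
rewrite -eX -es -et in st.
have [_ ii' [a [c [[e _] _ _ _ _]]]] := st.
apply: (noextL a c).
have [[h'a _ _] [h'c _ _] _ _] := e.
have Hm' : vert H `<=` vert (h m.+1) by move=> x /Hm; exact: ii'.1.
exact: (ext_pair_induced _ _ (limit_induced ch m.+1) Hm' h'a h'c).1.
Qed.

End Completion.

Lemma copy_code (V : set U) : countable V -> exists code : set U * U * U -> nat,
  forall X Y s t s' t', X `<=` V -> finite_set X -> X s -> X t ->
    Y `<=` V -> finite_set Y -> Y s' -> Y t' ->
    code (X, s, t) = code (Y, s', t') -> [/\ X = Y, s = s' & t = t'].
Proof.
move=> cV; pose D := [set A | A `<=` V /\ finite_set A] `*` V `*` V.
have /countable_injP[code codeI] : countable D.
  by do 2![apply: countableX => //]; exact: countable_finite_subset.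
exists code => X Y s t s' t' XV finX Xs Xt YV finY Ys' Yt'.
have DX : (X, s, t) \in D by rewrite inE; split; [split|]; rewrite //=; exact: XV.
have DY : (Y, s', t') \in D by rewrite inE; split; [split|]; rewrite //=; exact: YV.
by move=> /(codeI _ _ DX DY)[-> -> ->].
Qed.

(** An infinite sequence has a countable limit, so [U] has infinitely many other vertices. A
    countable set [N] of them keeps the possible copies countable, hence codable. *)
Lemma proper_extension S : ~ countable [set: U] -> PE_sequence Hh S ->
  exists S', proper_PE_sequence Hh S' /\
    induced_subgraph (limit_graph S) (limit_graph S').
Proof.
move=> uncU PS.
have [[i SN]|inf] := pselect (exists i, S i = None).
  by exists S; split; [exact: ended_proper SN|exact: induced_refl].
have cg := stabilize_chain PS.
have strict i : exists H, is_copy Hh (stabilize S i) H /\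
    pe_step (stabilize S i) (vert H) (root_s H) (root_t H) (stabilize S i.+1).
  have [_ /(_ i)] := PS.
  case E : (S i) => [G|]; last by case: inf; exists i.
  move=> [stepG nG].
  have [ex|/nG SN] := pselect (exists H, simplicial_copy Hh G H); last first.
    by case: inf; exists i.+1.
  have [H [G' [[cH simp] pe SG']]] := stepG ex; exists H.
  rewrite (stabilize_some PS E) (stabilize_some PS SG'); split=> //.
  by apply: pendant_extension_step => //; case: cH.
rewrite -(stabilize_limit PS); set L := limit _.
have cL : countable (vert L).
  apply: (@sub_countable _ _ _ (\bigcup_(i in [set: nat]) vert (stabilize S i))).
    by apply: subset_card_le => x /limit_vertP[i gx]; exists i.
  apply: bigcup_countable => // i _; apply: finite_set_countable.
  exact: (chain_finite cg).
have infC : infinite_set (~` vert L).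
  move=> finC; apply: uncU; rewrite -(setUv (vert L)).
  rewrite -bigcup2E; apply: bigcup_countable => // -[|[|i]] _ //=.
  exact: finite_set_countable.
have [x0 _] := infinite_setN0 infC.
have [nu [nuL nuI]] := card_le_injection x0 ((infiniteP _).1 infC).
pose N := range nu.
have infN : infinite_set N.
  apply/infiniteP; apply: (@injection_card_le _ _ _ _ nu); last exact: nuI.
  by move=> k _; exists k.
have cN : countable N by apply: sub_countable (card_image_le _ _) _.
have cV : countable (vert L `|` N).
  by rewrite -bigcup2E; apply: bigcup_countable => // -[|[|i]].
have [code codeI] := copy_code cV.
have [|||h [h0 hstep Lh hproper]] := @completion _ N _ code cg strict infN _ _ _ codeI.
- by move=> _ [k _ <-]; exact: nuL.
- by move=> x; left.
- by move=> x; right.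
exists (fun m => Some (h m)); split=> //; split=> //.
exact: strict_chain_PE_sequence.
Qed.

End Sequences.

(* Vertices are drawn from an arbitrary uncountable type U: limit graphs are
   countable, so new vertices are always available, even outside a limit. *)
Theorem theorem3p13 (U : Type) (hU : ~ countable [set: U])
    (Hh : two_rooted U) :
  [/\ exists S, proper_PE_sequence Hh S,
      forall S, PE_sequence Hh S ->
        exists S', proper_PE_sequence Hh S' /\
          induced_subgraph (limit_graph S) (limit_graph S')
    & graph_connected Hh ->
        forall S S', proper_PE_sequence Hh S -> proper_PE_sequence Hh S' ->
          isomorphic (limit_graph S) (limit_graph S')].
Proof.
split=> [||[_ conn] S S' [PS pS] [PS' pS']].
- have infU : infinite_set [set: U].
    by move=> /finite_set_countable.
  have [S PS] := PE_sequence_exists Hh infU.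
  by have [S' [pS' _]] := proper_extension hU PS; exists S'.
- by move=> S; exact: proper_extension.
rewrite -(stabilize_limit PS) -(stabilize_limit PS').
apply: (@proper_limits_isomorphic U Hh); rewrite ?stabilize_limit//.
- exact: stabilize_chain.
- exact: stabilize_chain.
- by apply: conn; [exact: root_s_vert|exact: root_t_vert].
Qed.
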